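(* Let $p\in[1,\infty)\setminus\{2\}$. Then there does not exist a unital contractive homomorphism $\mathcal{O}^p_2\otimes_p\mathcal{O}^p_2\to\mathcal{O}^p_2$.
   Context: Let $S_0,T_0,S_1,T_1\in\mathcal{B}(\ell^p(\mathbb{N}_0))$ be defined on the canonical basis $(\delta_k)_{k\in\mathbb{N}_0}$ by $S_j(\delta_k)=\delta_{2k+j}$, and $T_j(\delta_k)=\delta_l$ if $k=2l+j$, $T_j(\delta_k)=0$ otherwise. The $L^p$-Cuntz algebra $\mathcal{O}^p_2\subseteq\mathcal{B}(\ell^p(\mathbb{N}_0))$ is the Banach algebra generated by $S_0,T_0,S_1,T_1$. For $L^p$-operator algebras $A\subseteq\mathcal{B}(L^p(\mu))$ and $B\subseteq\mathcal{B}(L^p(\mu'))$ (isometrically and nondegenerately represented), the spatial tensor product $A\otimes_pB$ is the completion of the algebraic tensor product $A\odot B$ in the norm inherited from $\mathcal{B}(L^p(\mu\times\mu'))$, where $a\otimes b$ acts by $(a\otimes b)(\xi\otimes\xi')=a(\xi)\otimes b(\xi')$. Here the defining representations on $\ell^p(\mathbb{N}_0)$ are used, so $\mathcal{O}^p_2\otimes_p\mathcal{O}^p_2$ is the closed linear span of $\{a\otimes b: a,b\in\mathcal{O}^p_2\}$ in $\mathcal{B}(\ell^p(\mathbb{N}_0\times\mathbb{N}_0))$. *)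

(* Defs.v *)
From HB Require Import structures.
From mathcomp Require Import all_boot all_order all_algebra complex.
From mathcomp Require Import all_classical all_reals all_analysis.
From mathcomp Require Import ring lra.

Set Implicit Arguments.
Unset Strict Implicit.
Unset Printing Implicit Defensive.

Import Order.TTheory GRing.Theory Num.Theory.
Import numFieldNormedType.Exports.

Local Open Scope classical_set_scope.
Local Open Scope ring_scope.
Local Open Scope complex_scope.

(* `|x| : R[i] is real; rnorm x is the same number as an element of R *)
Section rnorm.
Context {R : realType}.

Definition rnorm {V : normedZmodType R[i]} (x : V) : R := complex.Re `|x|.

Section normed.
Context {V : normedZmodType R[i]}.
Implicit Types x y : V.

Lemma normE_rnorm x : `|x| = (rnorm x)%:C.
Proof. by rewrite /rnorm RRe_real// ger0_real. Qed.

Lemma rnorm_ge0 x : 0 <= rnorm x.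
Proof. by rewrite -ler0c -normE_rnorm. Qed.

Lemma rnorm0 : rnorm (0 : V) = 0. Proof. by rewrite /rnorm normr0. Qed.

Lemma rnorm_eq0 x : rnorm x = 0 -> x = 0.
Proof. by move=> x0; apply/eqP; rewrite -normr_eq0 normE_rnorm x0. Qed.

Lemma rnormD x y : rnorm (x + y) <= rnorm x + rnorm y.
Proof. by rewrite -lecR rmorphD/= -!normE_rnorm ler_normD. Qed.

End normed.

Lemma rnormM (x y : R[i]) : rnorm (x * y) = rnorm x * rnorm y.
Proof. by apply: complexI; rewrite rmorphM/= -!normE_rnorm normrM. Qed.

Lemma rnorm1 : rnorm (1 : R[i]) = 1. Proof. by rewrite /rnorm normr1. Qed.

Lemma rnormZ {V : normedModType R[i]} (c : R[i]) (x : V) :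
  rnorm (c *: x) = rnorm c * rnorm x.
Proof. by apply: complexI; rewrite rmorphM/= -!normE_rnorm normrZ. Qed.

Lemma rnorm_real (r : R) : 0 <= r -> rnorm r%:C = r.
Proof. by move=> r0; rewrite /rnorm ger0_norm// ler0c. Qed.

End rnorm.

Section esum_extra.
Context {R : realType} {I : choiceType}.
Local Open Scope ereal_scope.

Lemma esumZ (c : R) (a : I -> \bar R) : (0 <= c)%R -> (forall i, 0 <= a i) ->
  \esum_(i in [set: I]) (c%:E * a i) = c%:E * \esum_(i in [set: I]) a i.
Proof.
have leZ (d : R) (b : I -> \bar R) : (0 <= d)%R -> (forall i, 0 <= b i) ->
    \esum_(i in [set: I]) (d%:E * b i) <= d%:E * \esum_(i in [set: I]) b i.
  move=> d0 b0; apply: ge_ereal_sup => _ [F fF <-].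
  rewrite -ge0_mule_fsumr// lee_wpmul2l ?lee_fin//.
  by apply: ereal_sup_ubound; exists F.
move=> c0 a0; apply/eqP; rewrite eq_le leZ//=.
have [->|cN0] := eqVneq c 0%R.
  by rewrite mul0e esum_ge0// => i _; rewrite mul0e.
have c_gt0 : (0 < c)%R by rewrite lt_neqAle eq_sym cN0.
rewrite muleC -lee_pdivlMr// muleC.
apply: (le_trans _ (leZ _ _ _ _)); rewrite ?invr_ge0//; last first.
  by move=> i; rewrite mule_ge0.
by apply: le_esum => i _; rewrite muleA -EFinM mulVf// mul1e.
Qed.

Lemma esum_ge1 (a : I -> \bar R) (i : I) : 0 <= a i ->
  a i <= \esum_(i in [set: I]) a i.
Proof.
move=> a0; apply: esum_ge; exists [set i]; first by split.
by rewrite fsbig_set1.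
Qed.

End esum_extra.

Section psum.
Context {R : realType} (p : R) {I : choiceType}.
Hypothesis p1 : 1 <= p.
Implicit Types x y : I -> R[i].
Local Open Scope ereal_scope.

(* the p-th power of the l^p norm of x, possibly +oo *)
Definition psum x : \bar R := \esum_(i in [set: I]) (rnorm (x i) `^ p)%:E.

Let p_gt0 : (0 < p)%R. Proof. by rewrite (lt_le_trans _ p1). Qed.
Let p_neq0 : p != 0%R. Proof. by rewrite gt_eqF. Qed.

Lemma psum_ge0 x : 0 <= psum x.
Proof. by apply: esum_ge0 => i _; rewrite lee_fin powR_ge0. Qed.

Lemma psum0 : psum 0%R = 0.
Proof. by apply: esum1 => i _; rewrite rnorm0 powR0. Qed.

Lemma psumZ c x : psum (c *: x)%R = (rnorm c `^ p)%:E * psum x.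
Proof.
rewrite -esumZ ?powR_ge0//; last by move=> i; rewrite lee_fin powR_ge0.
by apply: eq_esum => i _; rewrite rnormM powRM ?rnorm_ge0.
Qed.

Lemma le_psum x i : (rnorm (x i) `^ p)%:E <= psum x.
Proof.
by apply: (esum_ge1 (a := fun i => (rnorm (x i) `^ p)%:E)); rewrite lee_fin powR_ge0.
Qed.

Lemma psum_eq0 x : psum x = 0 -> x = 0%R :> (I -> R[i]).
Proof.
move=> x0; apply/funext => i; apply: rnorm_eq0.
have := le_psum x i; rewrite x0 lee_fin => xi.
have /eqP : (rnorm (x i) `^ p = 0)%R by apply/le_anti; rewrite xi powR_ge0.
by rewrite powR_eq0 => /andP[/eqP].
Qed.

Let powR_convex_le (a b X Y : R) : (0 <= a -> 0 <= b -> 0 < X -> 0 < Y ->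
  (a + b) `^ p <= (X + Y) `^ p * (X / (X + Y)) / X `^ p * a `^ p +
                  (X + Y) `^ p * (Y / (X + Y)) / Y `^ p * b `^ p)%R.
Proof.
move=> a0 b0 X0 Y0.
have XY0 : (0 < X + Y)%R by rewrite addr_gt0.
have t01 : (0 <= X / (X + Y) <= 1)%R.
  apply/andP; split; first by rewrite divr_ge0// ltW.
  by rewrite ler_pdivrMr// mul1r lerDl ltW.
pose t := Itv01 (andP t01).1 (andP t01).2.
have aX0 : (0 <= a / X)%R by rewrite divr_ge0// ltW.
have bY0 : (0 <= b / Y)%R by rewrite divr_ge0// ltW.
have := @convex_powR R p p1 t (a / X)%R (b / Y)%R.
rewrite !inE/= !in_itv/= !andbT => /(_ aX0 bY0).
rewrite !convRE/= => h.
have tE : (1 - X / (X + Y) = Y / (X + Y))%R.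
  by apply/eqP; rewrite subr_eq -mulrDl addrC divff// gt_eqF.
have {h} : ((X / (X + Y) * (a / X) + Y / (X + Y) * (b / Y)) `^ p <=
   X / (X + Y) * (a / X) `^ p + Y / (X + Y) * (b / Y) `^ p)%R.
  by rewrite -tE.
have -> : (X / (X + Y) * (a / X) + Y / (X + Y) * (b / Y) = (a + b) / (X + Y))%R.
  by field; rewrite !gt_eqF.
rewrite !powRM ?invr_ge0 ?(ltW X0) ?(ltW Y0) ?(ltW XY0) ?addr_ge0//.
have powV (u : R) : (0 < u)%R -> (u^-1 `^ p = (u `^ p)^-1)%R.
  by move=> u0; rewrite -powR_inv1 ?ltW// -powRrM mulN1r powRN.
rewrite !powV// ler_pdivrMr ?powR_gt0//.
move=> /le_trans; apply; rewrite le_eqVlt; apply/orP; left; apply/eqP.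
by ring.
Qed.

Lemma psum_minkowski x y (X Y : R) : (0 <= X)%R -> (0 <= Y)%R ->
  psum x = (X `^ p)%:E -> psum y = (Y `^ p)%:E ->
  psum (x + y)%R <= ((X + Y) `^ p)%:E.
Proof.
rewrite le_eqVlt => /predU1P[<- Y0|X0].
  rewrite powR0// => /psum_eq0 -> yY; rewrite !add0r.
  by rewrite -yY.
rewrite le_eqVlt => /predU1P[<- |Y0].
  rewrite powR0// => xX /psum_eq0 ->; rewrite !addr0.
  by rewrite -xX.
move=> xX yY.
have XY0 : (0 < X + Y)%R by rewrite addr_gt0.
set c := ((X + Y) `^ p * (X / (X + Y)) / X `^ p)%R.
set d := ((X + Y) `^ p * (Y / (X + Y)) / Y `^ p)%R.
have c0 : (0 <= c)%R by rewrite !mulr_ge0 ?invr_ge0 ?powR_ge0 ?ltW.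
have d0 : (0 <= d)%R by rewrite !mulr_ge0 ?invr_ge0 ?powR_ge0 ?ltW.
apply: (@le_trans _ _ (c%:E * psum x + d%:E * psum y)); last first.
  rewrite xX yY -!EFinM -EFinD lee_fin.
  rewrite le_eqVlt; apply/orP; left; apply/eqP.
  rewrite /c /d !divfK ?gt_eqF ?powR_gt0// -mulrDr -mulrDl divff ?mulr1//.
  by rewrite gt_eqF.
rewrite -!esumZ//; try by move=> i; rewrite lee_fin powR_ge0.
rewrite -esumD; try by move=> i _; rewrite mule_ge0// lee_fin powR_ge0.
apply: le_esum => i _; rewrite -!EFinM -EFinD lee_fin.
apply: le_trans (powR_convex_le _ _ X0 Y0); rewrite ?rnorm_ge0//.
by apply: ge0_ler_powR; rewrite ?nnegrE ?addr_ge0 ?rnorm_ge0 ?rnormD// ltW.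
Qed.

End psum.

Section lp_space.
Context {R : realType} {p : R} (p1 : 1 <= p) (I : choiceType).

Definition finite_psum of 1 <= p : {pred I -> R[i]} :=
  fun x => (psum p x < +oo)%E.

Record lp := Lp { lp_val :> I -> R[i]; lp_valP : finite_psum p1 lp_val }.

HB.instance Definition _ := [isSub for lp_val].
HB.instance Definition _ := [Choice of lp by <:].

Lemma lpP (x y : lp) : x =1 y -> x = y.
Proof. by move=> xy; apply/val_inj/funext. Qed.

Definition lpnorm (x : I -> R[i]) : R := fine (psum p x) `^ p^-1.

Let p_gt0 : 0 < p. Proof. by rewrite (lt_le_trans _ p1). Qed.
Let p_neq0 : p != 0. Proof. by rewrite gt_eqF. Qed.

Lemma lpnorm_ge0 x : 0 <= lpnorm x. Proof. exact: powR_ge0. Qed.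

Lemma psumE x : finite_psum p1 x -> psum p x = (lpnorm x `^ p)%:E.
Proof.
move=> xoo; rewrite /lpnorm -powRrM mulVf// powRr1 ?fine_ge0 ?psum_ge0// fineK//.
by rewrite ge0_fin_numE ?psum_ge0.
Qed.

Lemma lpnorm_le x M : 0 <= M -> (psum p x <= (M `^ p)%:E)%E -> lpnorm x <= M.
Proof.
move=> M0 xM; rewrite /lpnorm.
have xoo : finite_psum p1 x by rewrite /finite_psum (le_lt_trans xM) ?ltry.
have -> : M = (M `^ p) `^ p^-1 by rewrite -powRrM divff// powRr1.
rewrite ge0_ler_powR ?invr_ge0 ?(ltW p_gt0)// ?nnegrE ?powR_ge0//.
  by rewrite fine_ge0 ?psum_ge0.
by rewrite -lee_fin fineK// ge0_fin_numE ?psum_ge0.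
Qed.

Lemma finite_psum_submod_closed : submod_closed (finite_psum p1).
Proof.
split; first by rewrite unfold_in/= psum0.
move=> c x y xoo yoo.
have cxoo : finite_psum p1 (c *: x).
  by rewrite /finite_psum psumZ// psumE// -EFinM ltry.
have := psum_minkowski p1 (lpnorm_ge0 _) (lpnorm_ge0 _) (psumE cxoo) (psumE yoo).
by move=> /le_lt_trans; apply; rewrite ltry.
Qed.

HB.instance Definition _ :=
  GRing.isSubmodClosed.Build _ _ (finite_psum p1) finite_psum_submod_closed.
HB.instance Definition _ := [SubChoice_isSubLmodule of lp by <:].

Lemma lpnormD (x y : lp) : lpnorm (x + y : lp) <= lpnorm x + lpnorm y.
Proof.
apply: lpnorm_le; first by rewrite addr_ge0 ?lpnorm_ge0.
by apply: psum_minkowski; rewrite ?lpnorm_ge0// psumE//; exact: lp_valP.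
Qed.

Lemma lpnormZ c (x : lp) : lpnorm (c *: x : lp) = rnorm c * lpnorm x.
Proof.
rewrite /lpnorm psumZ//= psumE; last exact: lp_valP.
rewrite -EFinM/= powRM ?powR_ge0// -!powRrM !divff// !powRr1 ?rnorm_ge0//.
Qed.

Lemma lpnorm_eq0 (x : lp) : lpnorm x = 0 -> x = 0.
Proof.
move=> x0; have xp : psum p x = 0%E.
  by rewrite psumE ?x0 ?powR0//; exact: lp_valP.
exact/val_inj/(psum_eq0 xp).
Qed.

Let lpnormCD (x y : lp) : (lpnorm (x + y : lp))%:C <= (lpnorm x)%:C + (lpnorm y)%:C.
Proof. by rewrite -rmorphD lecR lpnormD. Qed.

Let lpnormCZ (c : R[i]) (x : lp) :
  (lpnorm (c *: x : lp))%:C = `|c| * (lpnorm x)%:C.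
Proof. by rewrite lpnormZ rmorphM/= -normE_rnorm. Qed.

Let lpnormC_eq0 (x : lp) : (lpnorm x)%:C = 0 -> x = 0.
Proof. by move=> /complexI; exact: lpnorm_eq0. Qed.

HB.instance Definition _ := Lmodule_isNormed.Build R[i] lp
  lpnormCD lpnormCZ lpnormC_eq0.

Lemma lp_rnormE (x : lp) : rnorm x = lpnorm x.
Proof. by []. Qed.

End lp_space.

Section bounded_operators.
Context {R : realType} (E : normedModType R[i]).

Definition bounded_linear : {pred E -> E} := mem [set f : E -> E |
  linear f /\ exists M : R, forall x, rnorm (f x) <= M * rnorm x].

Record bop := Bop { bop_fun :> E -> E; bop_funP : bop_fun \in bounded_linear }.

HB.instance Definition _ := [isSub for bop_fun].
HB.instance Definition _ := [Choice of bop by <:].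

Lemma bopP (a b : bop) : a =1 b -> a = b.
Proof. by move=> ab; apply/val_inj/funext. Qed.

Lemma bounded_linear_submod_closed : submod_closed bounded_linear.
Proof.
split.
  rewrite inE/=; split; first by move=> c x y; rewrite /= scaler0 addr0.
  by exists 0 => x; rewrite rnorm0 mul0r.
move=> c f g; rewrite !inE/= => -[lf [M fM]] [lg [N gN]]; split.
  move=> d x y.
  rewrite [LHS](_ : _ = c *: f (d *: x + y) + g (d *: x + y))// lf lg.
  rewrite [RHS](_ : _ = d *: (c *: f x + g x) + (c *: f y + g y))//.
  by rewrite !scalerDr !scalerA (mulrC c d) addrACA.
exists (rnorm c * M + N) => x.
by rewrite mulrDl (le_trans (rnormD _ _))// lerD// rnormZ -mulrA ler_wpM2l ?rnorm_ge0.
Qed.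

HB.instance Definition _ :=
  GRing.isSubmodClosed.Build _ _ bounded_linear bounded_linear_submod_closed.
HB.instance Definition _ := [SubChoice_isSubLmodule of bop by <:].

Lemma bop_linear (a : bop) : linear a.
Proof. by have := bop_funP a; rewrite inE => -[]. Qed.

HB.instance Definition _ (a : bop) :=
  GRing.isLinear.Build R[i] E E *:%R a (bop_linear a).

Lemma bop_id_subproof : (@idfun E) \in bounded_linear.
Proof. by rewrite inE; split=> //; exists 1 => x; rewrite mul1r. Qed.

Lemma bop_comp_subproof (a b : bop) : (a \o b) \in bounded_linear.
Proof.
rewrite inE; split; first by move=> c x y; rewrite /= !linearP.
have := bop_funP a; rewrite inE => -[_ [M aM]].
have := bop_funP b; rewrite inE => -[_ [N bN]].
have M0 : M <= `|M| by rewrite ler_norm.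
exists (`|M| * N) => x; rewrite (le_trans (aM _))// -mulrA.
by rewrite (le_trans (ler_wpM2r (rnorm_ge0 _) M0))// ler_wpM2l.
Qed.

Definition bop_one := Bop bop_id_subproof.
Definition bop_mul (a b : bop) := Bop (bop_comp_subproof a b).

Let bop_mulA : associative bop_mul. Proof. by move=> *; apply: bopP. Qed.
Let bop_mul1l : left_id bop_one bop_mul. Proof. by move=> *; apply: bopP. Qed.
Let bop_mul1r : right_id bop_one bop_mul. Proof. by move=> *; apply: bopP. Qed.
Let bop_mulDl : left_distributive bop_mul +%R.
Proof. by move=> *; apply: bopP. Qed.
Let bop_mulDr : right_distributive bop_mul +%R.
Proof. by move=> a b c; apply: bopP => x /=; rewrite linearD. Qed.

HB.instance Definition _ := GRing.Zmodule_isPzRing.Build bop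
  bop_mulA bop_mul1l bop_mul1r bop_mulDl bop_mulDr.

Definition opnorm (a : bop) : R :=
  sup [set rnorm (a x) | x in [set x : E | rnorm x <= 1]].

Let opset (f : bop) := [set rnorm (f x) | x in [set x : E | rnorm x <= 1]].

Let opset_sup (a : bop) : has_sup (opset a).
Proof.
split; first by exists (rnorm (a 0)), 0 => //=; rewrite rnorm0.
have := bop_funP a; rewrite inE => -[_ [M aM]].
exists `|M| => _ [x x1 <-]; rewrite (le_trans (aM _))//.
rewrite (le_trans (ler_wpM2r (rnorm_ge0 _) (ler_norm M)))//.
by rewrite -[leRHS]mulr1 ler_wpM2l.
Qed.

Lemma opnorm_ge0 (a : bop) : 0 <= opnorm a.
Proof.
by apply: ub_le_sup (opset_sup a).2 _ _; exists 0; rewrite /= ?linear0 ?rnorm0.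
Qed.

Lemma le_opnorm (a : bop) x : rnorm (a x) <= opnorm a * rnorm x.
Proof.
have [->|x0] := eqVneq x 0; first by rewrite linear0 !rnorm0 mulr0.
have nx0 : 0 < rnorm x.
  by rewrite lt_neqAle rnorm_ge0 andbT eq_sym; apply: contra x0 => /eqP/rnorm_eq0->.
rewrite -ler_pdivrMr//; apply: ub_le_sup (opset_sup a).2 _ _.
have c0 : rnorm ((rnorm x)^-1%:C) = (rnorm x)^-1.
  by rewrite rnorm_real// invr_ge0 ltW.
exists ((rnorm x)^-1%:C *: x); first by rewrite /= rnormZ c0 mulVf// gt_eqF.
by rewrite linearZ/= rnormZ c0 mulrC.
Qed.

Lemma opnorm_le (a : bop) M : 0 <= M ->
  (forall x, rnorm (a x) <= M * rnorm x) -> opnorm a <= M.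
Proof.
move=> M0 aM; apply: ge_sup; first exact: (opset_sup a).1.
move=> _ [x x1 <-]; rewrite (le_trans (aM _))//.
by rewrite -[leRHS]mulr1 ler_wpM2l.
Qed.

Lemma opnormD (a b : bop) : opnorm (a + b) <= opnorm a + opnorm b.
Proof.
apply: opnorm_le => [|x]; first by rewrite addr_ge0 ?opnorm_ge0.
by rewrite mulrDl (le_trans (rnormD _ _))// lerD ?le_opnorm.
Qed.

Lemma opnormZ c (a : bop) : opnorm (c *: a) = rnorm c * opnorm a.
Proof.
have leZ d (b : bop) : opnorm (d *: b) <= rnorm d * opnorm b.
  apply: opnorm_le => [|x]; first by rewrite mulr_ge0 ?rnorm_ge0 ?opnorm_ge0.
  by rewrite /= rnormZ -mulrA ler_wpM2l ?rnorm_ge0 ?le_opnorm.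
apply/eqP; rewrite eq_le leZ/=.
have [->|c0] := eqVneq c 0; first by rewrite rnorm0 mul0r opnorm_ge0.
have -> : opnorm a = opnorm (c^-1 *: (c *: a)).
  by rewrite scalerA mulVf// scale1r.
rewrite (le_trans (ler_wpM2l (rnorm_ge0 _) (leZ _ _)))//.
by rewrite mulrA -rnormM divff// rnorm1 mul1r.
Qed.

Lemma opnorm_eq0 (a : bop) : opnorm a = 0 -> a = 0.
Proof.
move=> a0; apply: bopP => x; apply: rnorm_eq0.
by apply/le_anti; rewrite rnorm_ge0 andbT (le_trans (le_opnorm a x))// a0 mul0r.
Qed.

Let opnormCD (a b : bop) :
  (opnorm (a + b))%:C <= (opnorm a)%:C + (opnorm b)%:C.
Proof. by rewrite -rmorphD lecR opnormD. Qed.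

Let opnormCZ (c : R[i]) (a : bop) :
  (opnorm (c *: a))%:C = `|c| * (opnorm a)%:C.
Proof. by rewrite opnormZ rmorphM/= -normE_rnorm. Qed.

Let opnormC_eq0 (a : bop) : (opnorm a)%:C = 0 -> a = 0.
Proof. by move=> /complexI; exact: opnorm_eq0. Qed.

HB.instance Definition _ := Lmodule_isNormed.Build R[i] bop
  opnormCD opnormCZ opnormC_eq0.

Lemma bop_rnormE (a : bop) : rnorm a = opnorm a.
Proof. by []. Qed.

End bounded_operators.

Arguments bounded_linear {R} E.

Section lp_operators.
Context {R : realType} {p : R} (p1 : 1 <= p).
Implicit Types I J : choiceType.

Let p_gt0 : 0 < p. Proof. by rewrite (lt_le_trans _ p1). Qed.
Let p_neq0 : p != 0. Proof. by rewrite gt_eqF. Qed.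

Lemma psum_lpE I (x : lp p1 I) : psum p x = (rnorm x `^ p)%:E.
Proof. by rewrite lp_rnormE (psumE (p1 := p1))//; exact: lp_valP. Qed.

Lemma psum_bound I J (x : lp p1 I) (y : lp p1 J) (M : R) : 0 <= M ->
  (psum p y <= (M `^ p)%:E * psum p x)%E -> rnorm y <= M * rnorm x.
Proof.
move=> M0; rewrite (psum_lpE x) -EFinM -powRM ?rnorm_ge0// => xy.
by rewrite lp_rnormE (lpnorm_le p1)// mulr_ge0// rnorm_ge0.
Qed.

Lemma psum_bounded_linear I (f : lp p1 I -> lp p1 I) (M : R) : 0 <= M ->
  linear f -> (forall x, (psum p (f x) <= (M `^ p)%:E * psum p x)%E) ->
  f \in bounded_linear (lp p1 I).
Proof.
by move=> M0 lf fM; rewrite inE/=; split=> //; exists M => x; exact: psum_bound.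
Qed.

Lemma psum_bop I (a : bop (lp p1 I)) x :
  (psum p (a x) <= (opnorm a `^ p)%:E * psum p x)%E.
Proof.
rewrite !psum_lpE -EFinM lee_fin -powRM ?rnorm_ge0 ?opnorm_ge0//.
by rewrite ge0_ler_powR ?nnegrE ?le_opnorm ?mulr_ge0 ?rnorm_ge0 ?opnorm_ge0// ltW.
Qed.

Lemma psum_deltaE I (k : I) :
  psum p (fun i => (i == k)%:R : R[i]) = 1%E.
Proof.
have -> : 1%E = (rnorm (1 : R[i]) `^ p)%:E by rewrite rnorm1 powR1.
rewrite /psum -(@esum_set1 _ _ k (fun=> (rnorm (1 : R[i]) `^ p)%:E)); last first.
  by rewrite lee_fin powR_ge0.
rewrite [RHS]esum_mkcond; apply: eq_esum => i _.
by rewrite in_set1; case: eqP => //= _; rewrite rnorm0 powR0.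
Qed.

Lemma finite_psum_delta I (k : I) :
  finite_psum p1 (fun i => (i == k)%:R : R[i]).
Proof. by rewrite /finite_psum psum_deltaE ltry. Qed.

Definition delta I (k : I) : lp p1 I := Lp (finite_psum_delta k).

(* the basis vectors span a dense subspace, since p < +oo *)
Lemma bop_ext I (a b : bop (lp p1 I)) :
  (forall k, a (delta k) = b (delta k)) -> a = b.
Proof.
move=> ab; apply/subr0_eq; set c := a - b.
have c0 k : c (delta k) = 0.
  by rewrite [LHS](_ : _ = a (delta k) - b (delta k))// ab subrr.
clearbody c; apply: bopP => x; apply: rnorm_eq0; apply/le_anti; rewrite rnorm_ge0 andbT.
have small e : 0 < e -> rnorm (c x) <= opnorm c * e.
  move=> e0; have ep0 : 0 < e `^ p by rewrite powR_gt0.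
  have xfin : psum p x \is a fin_num by rewrite psum_lpE.
  have [_ [F [finF _] <-]] := ub_ereal_sup_adherent ep0 xfin.
  move=> xF.
  pose y : lp p1 I := \sum_(i <- finmap.enum_fset (fset_set F)) x i *: delta i.
  have cy : c y = 0.
    by rewrite linear_sum big1// => i _; rewrite linearZ/= c0 scaler0.
  have yE i : y i = if i \in F then x i else 0.
    have -> : y i = \sum_(k <- finmap.enum_fset (fset_set F)) x k * (i == k)%:R.
      rewrite /y; elim/big_rec2: _ => // k u v _ <-.
      by [].
    case: ifPn => iF.
      rewrite (bigD1_seq i)/= ?finmap.fset_uniq ?in_fset_set// eqxx mulr1.
      by rewrite big1 ?addr0// => k; rewrite eq_sym => /negbTE->; rewrite mulr0.
    rewrite big_seq big1// => k; rewrite in_fset_set// => kF.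
    by case: eqP => [ik|_]; [rewrite ik kF in iF|rewrite mulr0].
  pose z : lp p1 I := x - y.
  have zF : (psum p z <= (e `^ p)%:E)%E.
    have : (psum p x - (e `^ p)%:E < \sum_(i \in F) (rnorm (x i) `^ p)%:E)%E.
      exact: xF.
    rewrite {1}/psum (esumID F); last first.
      by move=> i _; rewrite lee_fin powR_ge0.
    rewrite !setTI esum_fset//; last by move=> i _; rewrite lee_fin powR_ge0.
    have -> : (\esum_(i in ~` F) (rnorm (x i) `^ p)%:E =
              \esum_(i in [set: I]) (rnorm (z i) `^ p)%:E)%E.
      rewrite esum_mkcond; apply: eq_esum => i _.
      rewrite [z i](_ : _ = x i - y i)// yE in_setC.
      by case: (i \in F) => /=; rewrite ?subrr ?subr0 ?rnorm0 ?powR0.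
    rewrite -/(psum p z) (psum_lpE z) fsbig_finite//= sumEFin.
    by rewrite -!EFinD lte_fin lee_fin; lra.
  have -> : c x = c z by rewrite /z linearB/= cy subr0.
  rewrite (le_trans (le_opnorm _ _))// ler_wpM2l ?opnorm_ge0//.
  by rewrite lp_rnormE (lpnorm_le p1)// ltW.
have [c00|cN0] := eqVneq (opnorm c) 0.
  by rewrite (le_trans (small 1 _))// c00 mul0r.
have c_gt0 : 0 < opnorm c by rewrite lt_neqAle eq_sym cN0 opnorm_ge0.
apply/ler_addgt0Pl => e e0; rewrite addr0.
rewrite (le_trans (small (e / opnorm c) _)) ?divr_gt0//.
by rewrite mulrC divfK.
Qed.

Section cuntz_generators.
Implicit Types (j : bool) (x y : lp p1 nat).

(* opS and opT below are given by their action on all of l^p; opS_delta,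
   opT_delta and opT_delta0 give it on the basis, and by bop_ext these
   determine the operators. *)
Definition Sfun j (x : nat -> R[i]) (n : nat) : R[i] :=
  if odd n == j then x n./2 else 0.

Definition Tfun j (x : nat -> R[i]) (n : nat) : R[i] := x (j + n.*2)%N.

Lemma psum_Sfun j (x : nat -> R[i]) : psum p (Sfun j x) = psum p x.
Proof.
pose D := [set n : nat | odd n == j].
rewrite /psum [RHS](@reindex_esum _ _ _ D setT (fun n => n./2)); last first.
  split=> //.
  - move=> m n; rewrite !inE/= => /eqP mj /eqP nj mn.
    by rewrite -(odd_double_half m) -(odd_double_half n) mj nj mn.
  - move=> n _; exists (j + n.*2)%N; last by rewrite half_bit_double.
    by rewrite /D/= oddD odd_double addbF; case: (j).
rewrite [RHS]esum_mkcond; apply: eq_esum => n _.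
have -> : (n \in D) = (odd n == j) by apply/idP/idP; rewrite inE.
by rewrite /Sfun; case: ifP => // _; rewrite rnorm0 powR0.
Qed.

Lemma psum_Tfun j (x : nat -> R[i]) : (psum p (Tfun j x) <= psum p x)%E.
Proof.
pose D := [set n : nat | odd n == j].
rewrite /psum -(@reindex_esum _ _ _ setT D (fun n => (j + n.*2)%N)
  (fun n => (rnorm (x n) `^ p)%:E)); last first.
  split=> //.
  - by move=> n _; rewrite /D/= oddD odd_double addbF; case: (j).
  - by move=> m n _ _ /(congr1 half); rewrite !half_bit_double.
  - move=> n /eqP nj; exists n./2 => //.
    by rewrite -[RHS](odd_double_half n) nj.
rewrite esum_mkcond; apply: le_esum => n _; case: ifP => // _.
by rewrite lee_fin powR_ge0.
Qed.

Lemma Sfun_finite j x : finite_psum p1 (Sfun j x).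
Proof. by rewrite /finite_psum psum_Sfun; exact: lp_valP. Qed.

Lemma Tfun_finite j x : finite_psum p1 (Tfun j x).
Proof. by rewrite /finite_psum (le_lt_trans (psum_Tfun j x))//; exact: lp_valP. Qed.

Let Slp j x : lp p1 nat := Lp (Sfun_finite j x).
Let Tlp j x : lp p1 nat := Lp (Tfun_finite j x).

Lemma S_bounded j : Slp j \in bounded_linear (lp p1 nat).
Proof.
apply: (@psum_bounded_linear _ _ 1) => // [c x y|x]; last first.
  by rewrite powR1 mul1e [leLHS]psum_Sfun.
apply: lpP => n; rewrite /= /Sfun.
case: ifP => nj; rewrite [RHS](_ : _ = c * Sfun j x n + Sfun j y n)//.
  by rewrite /Sfun nj.
by rewrite /Sfun nj mulr0 addr0.
Qed.

Lemma T_bounded j : Tlp j \in bounded_linear (lp p1 nat).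
Proof.
apply: (@psum_bounded_linear _ _ 1) => // [c x y|x]; last first.
  by rewrite powR1 mul1e; exact: psum_Tfun.
exact: lpP.
Qed.

Definition opS j : bop (lp p1 nat) := Bop (S_bounded j).
Definition opT j : bop (lp p1 nat) := Bop (T_bounded j).

Let eq_bit_double n k j :
  (n == (2 * k + j)%N) = (odd n == j) && (n./2 == k).
Proof.
apply/eqP/andP => [->|[/eqP <- /eqP <-]].
  by rewrite mul2n addnC half_bit_double oddD odd_double addbF oddb !eqxx.
by rewrite mul2n addnC odd_double_half.
Qed.

Lemma opS_delta j k : opS j (delta k) = delta (2 * k + j)%N.
Proof.
by apply: lpP => n /=; rewrite /Sfun eq_bit_double /=; case: eqP.
Qed.

Lemma opT_delta j l : opT j (delta (2 * l + j)%N) = delta l.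
Proof.
apply: lpP => n /=; rewrite /Tfun eq_bit_double /=.
by rewrite half_bit_double oddD odd_double addbF oddb eqxx.
Qed.

Lemma opT_delta0 j k : (forall l, k <> 2 * l + j)%N -> opT j (delta k) = 0.
Proof.
move=> kj; apply: lpP => n /=; rewrite /Tfun/=.
by case: eqP => // nk; have := kj n; rewrite -nk mul2n addnC.
Qed.

End cuntz_generators.

Section tensor.
Context {I J : choiceType}.

Lemma psum_prodE (z : I * J -> R[i]) : (psum p z =
  \esum_(i in [set: I]) psum p (fun j => z (i, j)))%E.
Proof.
rewrite esum_esum; last by move=> *; rewrite lee_fin powR_ge0.
rewrite (_ : _ `*`` _ = setT); last by apply/seteqP; split.
by apply: eq_esum => -[].
Qed.

Lemma psum_prodEr (z : I * J -> R[i]) : (psum p z =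
  \esum_(j in [set: J]) psum p (fun i => z (i, j)))%E.
Proof.
rewrite esum_esum; last by move=> *; rewrite lee_fin powR_ge0.
rewrite (_ : _ `*`` _ = setT); last by apply/seteqP; split.
rewrite /psum (@reindex_esum _ _ _ setT setT (fun k : J * I => (k.2, k.1)))//.
split=> //; first by move=> [? ?] [? ?] _ _ /= [-> ->].
by move=> [i j] _; exists (j, i).
Qed.

Lemma row_finite (z : lp p1 (I * J)%type) i :
  finite_psum p1 (fun j => z (i, j)).
Proof.
rewrite /finite_psum (@le_lt_trans _ _ (psum p z))//; last exact: lp_valP.
rewrite psum_prodE (esum_ge1 (a := fun i => psum p (fun j => z (i, j))))//.
exact: psum_ge0.
Qed.

Lemma col_finite (z : lp p1 (I * J)%type) j :
  finite_psum p1 (fun i => z (i, j)).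
Proof.
rewrite /finite_psum (@le_lt_trans _ _ (psum p z))//; last exact: lp_valP.
rewrite psum_prodEr (esum_ge1 (a := fun j => psum p (fun i => z (i, j))))//.
exact: psum_ge0.
Qed.

Definition row_lp (z : lp p1 (I * J)%type) i : lp p1 J := Lp (row_finite z i).
Definition col_lp (z : lp p1 (I * J)%type) j : lp p1 I := Lp (col_finite z j).

Let ampl_psum (a : bop (lp p1 I)) (z : lp p1 (I * J)%type) :
  (psum p (fun k : I * J => a (col_lp z k.2) k.1) <=
   (opnorm a `^ p)%:E * psum p z)%E.
Proof.
rewrite !psum_prodEr -esumZ ?powR_ge0//; last by move=> *; exact: psum_ge0.
by apply: le_esum => j _; exact: (psum_bop a (col_lp z j)).
Qed.

Let ampr_psum (b : bop (lp p1 J)) (z : lp p1 (I * J)%type) :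
  (psum p (fun k : I * J => b (row_lp z k.1) k.2) <=
   (opnorm b `^ p)%:E * psum p z)%E.
Proof.
rewrite !psum_prodE -esumZ ?powR_ge0//; last by move=> *; exact: psum_ge0.
by apply: le_esum => i _; exact: (psum_bop b (row_lp z i)).
Qed.

Let ampl_finite (a : bop (lp p1 I)) (z : lp p1 (I * J)%type) :
  finite_psum p1 (fun k : I * J => a (col_lp z k.2) k.1).
Proof. by rewrite /finite_psum (le_lt_trans (ampl_psum a z))// psum_lpE ltry. Qed.

Let ampr_finite (b : bop (lp p1 J)) (z : lp p1 (I * J)%type) :
  finite_psum p1 (fun k : I * J => b (row_lp z k.1) k.2).
Proof. by rewrite /finite_psum (le_lt_trans (ampr_psum b z))// psum_lpE ltry. Qed.

Let ampl_bounded (a : bop (lp p1 I)) :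
  (fun z => Lp (ampl_finite a z)) \in bounded_linear (lp p1 (I * J)%type).
Proof.
apply: (@psum_bounded_linear _ _ (opnorm a)); [exact: opnorm_ge0| |exact: ampl_psum].
move=> c x y; apply: lpP => -[i j] /=.
rewrite [RHS](_ : _ = (c *: a (col_lp x j) + a (col_lp y j)) i)// -linearP.
by congr (a _ i); apply: lpP.
Qed.

Let ampr_bounded (b : bop (lp p1 J)) :
  (fun z => Lp (ampr_finite b z)) \in bounded_linear (lp p1 (I * J)%type).
Proof.
apply: (@psum_bounded_linear _ _ (opnorm b)); [exact: opnorm_ge0| |exact: ampr_psum].
move=> c x y; apply: lpP => -[i j] /=.
rewrite [RHS](_ : _ = (c *: b (row_lp x i) + b (row_lp y i)) j)// -linearP.
by congr (b _ j); apply: lpP.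
Qed.

(* a (x) 1 and 1 (x) b, acting on each column, resp. row, of an element of
   l^p(I * J); tensopE and tensop_uniq characterize a (x) b = tensop a b. *)
Definition ampl (a : bop (lp p1 I)) : bop (lp p1 (I * J)%type) :=
  Bop (ampl_bounded a).
Definition ampr (b : bop (lp p1 J)) : bop (lp p1 (I * J)%type) :=
  Bop (ampr_bounded b).

Definition tensop (a : bop (lp p1 I)) (b : bop (lp p1 J)) : bop (lp p1 (I * J)%type) := ampl a * ampr b.

Lemma tensv_finite (x : lp p1 I) (y : lp p1 J) :
  finite_psum p1 (fun k : I * J => x k.1 * y k.2).
Proof.
rewrite /finite_psum psum_prodE.
rewrite (@eq_esum _ _ _ _
  (fun i => (rnorm y `^ p)%:E * (rnorm (x i) `^ p)%:E)%E); last first.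
  by move=> i _; rewrite -psum_lpE muleC -psumZ.
rewrite esumZ ?powR_ge0//; last by move=> i; rewrite lee_fin powR_ge0.
by rewrite -/(psum p x) psum_lpE -EFinM ltry.
Qed.

Definition tensv (x : lp p1 I) (y : lp p1 J) : lp p1 (I * J)%type :=
  Lp (tensv_finite x y).

Lemma tensopE (a : bop (lp p1 I)) (b : bop (lp p1 J)) x y : tensop a b (tensv x y) = tensv (a x) (b y).
Proof.
have bE : ampr b (tensv x y) = tensv x (b y).
  apply: lpP => -[i j] /=; rewrite (_ : row_lp _ _ = x i *: y) ?linearZ//.
  exact: lpP.
rewrite [LHS](_ : _ = ampl a (ampr b (tensv x y)))// bE.
apply: lpP => -[i j] /=.
rewrite (_ : col_lp _ _ = b y j *: x); first by rewrite linearZ/= mulrC.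
by apply: lpP => k /=; rewrite mulrC.
Qed.

Lemma tensop_uniq (a : bop (lp p1 I)) (b : bop (lp p1 J))
    (c : bop (lp p1 (I * J)%type)) :
  (forall x y, c (tensv x y) = tensv (a x) (b y)) -> c = tensop a b.
Proof.
move=> cab; apply: bop_ext => -[i j].
rewrite (_ : delta _ = tensv (delta i) (delta j)) ?cab ?tensopE//.
by apply: lpP => -[k l] /=; rewrite xpair_eqE -natrM mulnb.
Qed.

End tensor.

End lp_operators.

Section operator_algebras.
Context {R : realType} {E : normedModType R[i]}.
Implicit Types A G : set (bop E).

Definition linear_subspace A : Prop :=
  A 0 /\ forall (c : R[i]) a b, A a -> A b -> A (c *: a + b).

Definition closed_subalgebra A : Prop :=
  [/\ closed A, linear_subspace A & forall a b, A a -> A b -> A (a * b)].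

Definition linear_span G : set (bop E) := smallest linear_subspace G.

Definition banach_algebra_generated G : set (bop E) :=
  smallest closed_subalgebra G.

End operator_algebras.

Definition cuntz_alg {R : realType} {p : R} (p1 : 1 <= p) :
    set (bop (lp p1 nat)) :=
  banach_algebra_generated
    [set opS p1 false; opT p1 false; opS p1 true; opT p1 true].

(* A and B are represented on l^p spaces, so a (x) b acts on l^p(I * J), which
   is the L^p space of the product of the counting measures on I and J. *)
Definition spatial_tensor {R : realType} {p : R} {p1 : 1 <= p}
    {I J : choiceType} (A : set (bop (lp p1 I))) (B : set (bop (lp p1 J))) :
    set (bop (lp p1 (I * J)%type)) :=
  closure (linear_span [set tensop a b | a in A & b in B]).

Arguments cuntz_alg {R p} p1.

(* A homomorphism from A to B is represented by a total function phi, of which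
   only the restriction to A matters. *)
Definition unital_contractive_hom {R : realType} {E F : normedModType R[i]}
    (A : set (bop E)) (B : set (bop F)) (phi : bop E -> bop F) : Prop :=
  [/\ forall a, A a -> B (phi a),
      forall (c : R[i]) a b, A a -> A b -> phi (c *: a + b) = c *: phi a + phi b,
      forall a b, A a -> A b -> phi (a * b) = phi a * phi b,
      phi 1 = 1
    & forall a, A a -> `|phi a| <= `|a|].

Section units.
Context {R : realType} {p : R} (p1 : 1 <= p).

Lemma cuntz_alg1 : cuntz_alg p1 1.
Proof.
have -> : 1 = opT p1 false * opS p1 false.
  apply: bop_ext => k.
  rewrite [RHS](_ : _ = opT p1 false (opS p1 false (delta p1 k)))//.
  by rewrite opS_delta opT_delta.
move=> A [[_ _ AM] AG]; apply: AM; apply: AG => /=; tauto.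
Qed.

Lemma spatial_tensor1 : spatial_tensor (cuntz_alg p1) (cuntz_alg p1) 1.
Proof.
apply: subset_closure; apply: sub_gen_smallest.
exists 1; first exact: cuntz_alg1.
by exists 1; [exact: cuntz_alg1|exact/esym/tensop_uniq].
Qed.

End units.

(* Main.v *)
Require Import Defs.
From mathcomp Require Import all_boot all_order all_algebra complex.
From mathcomp Require Import all_classical all_reals all_analysis.
From mathcomp Require Import ring lra zify.

Set Implicit Arguments.
Unset Strict Implicit.
Unset Printing Implicit Defensive.

Import Order.TTheory GRing.Theory Num.Theory.
Import numFieldNormedType.Exports.

Local Open Scope classical_set_scope.
Local Open Scope ring_scope.
Local Open Scope complex_scope.

(* A homomorphism as in the theorem restricts to two commuting unital contractive
   homomorphisms psi, psi' from O to O.  As p <> 2, isometries of l^p preserve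
   disjointness of supports (Lamperti), so psi maps diagonal projections of O to
   diagonal projections, and psi'(S_0), psi'(S_1) permute the basis, up to
   scalars, through injections sig_0, sig_1 with disjoint images; the supports of
   the former are invariant under the latter.  Up to an arbitrarily small error,
   an element of O is a linear combination of operators that map all but finitely
   many residue classes modulo powers of 2 (cylinders) onto such classes or to 0.
   Hence each of those supports splits only finitely many cylinders, and sig_0,
   sig_1 send all but N of them to two distinct split cylinders, so that at most
   2N are split, where N depends on psi' only.  Thus no cylinder of a certain
   level, the same for all supports, is split, and only finitely many supports
   can be pairwise disjoint, whereas O contains infinitely many pairwise
   orthogonal nonzero diagonal projections. *)

(** * Combinatorics of cylinders and of sets invariant under two disjoint injections *)

Section cylinders.
Local Open Scope nat_scope.

(* If c = 2 ^ k + r with r < 2 ^ k, then m |-> cyl c m enumerates, from cyl c 0 = c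
   on, the numbers congruent to r modulo 2 ^ k other than r itself: c encodes
   the cylinder of the k-bit word r.  The case c = 0 is junk. *)
Definition cyl (c m : nat) : nat := c + 2 ^ trunc_log 2 c * m.

Lemma cyl_log c : 0 < c ->
  exists k r, [/\ r < 2 ^ k, c = 2 ^ k + r & forall m, cyl c m = r + 2 ^ k * m.+1].
Proof.
move=> c0; have /andP[] := @trunc_log_bounds 2 c isT c0.
set k := trunc_log 2 c => kc ck; exists k, (c - 2 ^ k).
rewrite expnS in ck; split; [lia|lia|].
by move=> m; rewrite /cyl -/k mulnS; lia.
Qed.

Lemma cylE k r m : r < 2 ^ k -> cyl (2 ^ k + r) m = r + 2 ^ k * m.+1.
Proof.
move=> rk; rewrite /cyl (@trunc_log_eq 2 k)//; first by rewrite mulnS; lia.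
by rewrite leq_addr/= expnS; lia.
Qed.

Lemma cyl0 c : cyl c 0 = c. Proof. by rewrite /cyl muln0 addn0. Qed.

Lemma leq_cyl c m : c <= cyl c m.
Proof. exact: leq_addr. Qed.

(** The code is designed for this: [opS j] acts on the codes of cylinders by the same formula as on
    the indices of basis vectors. *)
Lemma cyl_double c (j : bool) m : 0 < c -> cyl (2 * c + j) m = 2 * cyl c m + j.
Proof.
move=> /cyl_log[k [r [rk -> ->]]].
have -> : 2 * (2 ^ k + r) + j = 2 ^ k.+1 + (2 * r + j) by rewrite expnS; lia.
by rewrite cylE expnS; [lia|case: (j); lia].
Qed.

(** For a code of level k, the number with index m lies between 2^k (m + 1), included, and 2^k (m +
    2), excluded; these intervals are disjoint for distinct k. *)
Lemma cyl_inj c d m : 0 < c -> 0 < d -> cyl c m = cyl d m -> c = d.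
Proof.
wlog: c d / c <= d.
  move=> h c0 d0 cd; case: (leqP c d) => [|/ltnW] le; first exact: h.
  by apply/esym/h.
move=> cd /cyl_log[k [r [rk -> ->]]] /cyl_log[l [t [tl -> ->]]].
case: (ltngtP k l) => [kl|lk|->]; last by lia.
  have : 2 ^ k.+1 <= 2 ^ l by rewrite leq_exp2l.
  rewrite expnS => h e; exfalso.
  have : 2 * 2 ^ k * m.+1 <= 2 ^ l * m.+1 by rewrite leq_mul2r h orbT.
  by nia.
have : 2 ^ l.+1 <= 2 ^ k by rewrite leq_exp2l.
rewrite expnS => h e; exfalso.
have : 2 * 2 ^ l * m.+1 <= 2 ^ k * m.+1 by rewrite leq_mul2r h orbT.
by nia.
Qed.

(** The code of the cylinder of level k that contains [c], provided that 2^k <= c. *)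
Definition ancestor k c := 2 ^ k + c %% 2 ^ k.

Lemma cyl_ancestor k c : 2 ^ k <= c -> c = cyl (ancestor k c) (c %/ 2 ^ k).-1.
Proof.
move=> kc; have k0 : 0 < 2 ^ k by rewrite expn_gt0.
have q0 : 0 < c %/ 2 ^ k by rewrite divn_gt0.
by rewrite cylE ?ltn_pmod// prednK// {1}(divn_eq c (2 ^ k)) addnC mulnC.
Qed.

Lemma ancestor_cyl k c m : 2 ^ k <= c -> ancestor k (cyl c m) = ancestor k c.
Proof.
move=> kc; rewrite /ancestor /cyl; congr (_ + _).
have /dvdnP[q ->] : 2 ^ k %| 2 ^ trunc_log 2 c by rewrite dvdn_exp2l// trunc_log_max.
by rewrite mulnAC addnC modnMDl.
Qed.

Lemma ancestor_bounds k c : 2 ^ k <= ancestor k c < 2 ^ k.+1.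
Proof.
rewrite /ancestor leq_addr/= expnS mul2n -addnn ltn_add2l ltn_pmod//.
by rewrite expn_gt0.
Qed.

(** Ancestors of distinct levels lie in disjoint dyadic intervals. *)
Lemma ancestor_inj c : injective (ancestor ^~ c).
Proof.
have le k l : ancestor k c = ancestor l c -> k <= l.
  move=> kl; have /andP[_ la] := ancestor_bounds l c.
  have /andP[ak _] := ancestor_bounds k c.
  have := leq_ltn_trans ak (eq_ind_r (fun n => n < 2 ^ l.+1) la kl).
  by rewrite ltn_exp2l.
by move=> k l kl; apply/eqP; rewrite eqn_leq !le.
Qed.

Definition jointly_injective (sig : bool -> nat -> nat) :=
  forall j k c d, sig j c = sig k d -> j = k /\ c = d.

(** At most [N] elements of [s] are below [N]; each of the others has two images in [s], and all
    these images are distinct. Hence 2 (size s - N) <= size s. *)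
Lemma doubling_size (sig : bool -> nat -> nat) N (s : seq nat) : jointly_injective sig ->
  uniq s -> (forall j c, c \in s -> N <= c -> sig j c \in s) -> size s <= 2 * N.
Proof.
move=> sigI us sigs.
have inj j : injective (sig j) by move=> c d /sigI[].
pose t := [seq c <- s | N <= c].
have ut : uniq (map (sig false) t ++ map (sig true) t).
  rewrite cat_uniq !map_inj_uniq// !filter_uniq//= andbT.
  by apply/hasPn => _ /mapP[c _ ->]; apply/mapP => -[d _ /sigI[]].
have := @uniq_leq_size _ _ s ut.
have -> : size (map (sig false) t ++ map (sig true) t) = 2 * size t.
  by rewrite size_cat !size_map; lia.
have ts : size s <= size t + N.
  rewrite -(count_predC (leq N) s) -size_filter leq_add2l -size_filter.
  rewrite -[leqRHS](size_iota 0); apply: uniq_leq_size; first exact: filter_uniq.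
  by move=> c; rewrite mem_filter mem_iota/= add0n -ltnNge => /andP[].
have sub : {subset map (sig false) t ++ map (sig true) t <= s}.
  by move=> c; rewrite mem_cat => /orP[] /mapP[d];
    rewrite mem_filter => /andP[Nd ds] ->; exact: sigs.
move=> /(_ sub) ss; have {}ss : 2 * size t <= size s := ss.
by lia.
Qed.

(** Since [cyl c 0 = c], this says that [X] is not constant on the cylinder of [c]. *)
Definition splits (X : pred nat) c := `[< exists m, X (cyl c m) != X c >].

Section disjoint_injections.
Variables (sig : bool -> nat -> nat) (N : nat).
Hypothesis sigI : jointly_injective sig.
Hypothesis sig_cyl : forall j c m, N <= c -> sig j (cyl c m) = cyl (sig j c) m.

Section invariant_set.
Variables (X : pred nat) (M : nat).
Hypothesis X_cyl : forall c m, M <= c -> X (cyl c m) = X c.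
Hypothesis X_sig : forall j c, X (sig j c) = X c.

(** By [X_cyl] only finitely many cylinders are split, and [sig j] maps split codes from [N] on to
    split codes. The resulting bound does not depend on [M]. *)
Lemma splits_size s : uniq s -> all (splits X) s -> size s <= 2 * N.
Proof.
move=> us /allP sX.
pose t := [seq c <- iota 0 M | splits X c].
have tE c : (c \in t) = splits X c.
  rewrite mem_filter mem_iota/= add0n andb_idr// => /asboolP[m].
  by case: (ltnP c M) => // /X_cyl ->; rewrite eqxx.
apply: (@leq_trans (size t)).
  by apply: uniq_leq_size => // c /sX; rewrite tE.
apply: doubling_size sigI _ _; first by rewrite filter_uniq ?iota_uniq.
move=> j c; rewrite !tE => /asboolP[m Xm] Nc; apply/asboolP; exists m.
by rewrite -sig_cyl// !X_sig.
Qed.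

Lemma splits_ancestor k c : 2 ^ k <= c -> splits X c -> splits X (ancestor k c).
Proof.
move=> kc /asboolP[m cm]; apply/asboolP/not_existsP => h.
have hX d : 2 ^ k <= d -> ancestor k d = ancestor k c -> X d = X (ancestor k c).
  move=> kd dc; rewrite {1}(cyl_ancestor kd) dc.
  by apply/eqP/negPn/negP; exact: h.
move: cm; rewrite !hX ?eqxx ?ancestor_cyl//.
by rewrite (leq_trans kc)// leq_cyl.
Qed.

(** Otherwise the ancestors of [c] of levels 0 to 2N would be 2N + 1 distinct split codes. *)
Lemma splits_bound c : 2 ^ (2 * N) <= c -> ~~ splits X c.
Proof.
move=> Nc; apply/negP => Xc.
have := @splits_size [seq ancestor k c | k <- iota 0 (2 * N).+1].
rewrite map_inj_uniq ?iota_uniq; last exact: ancestor_inj.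
rewrite size_map size_iota ltnn => h; suff : false by []; apply: h => //.
apply/allP => _ /mapP[k + ->]; rewrite mem_iota/= add0n ltnS => kN.
by apply: splits_ancestor => //; rewrite (leq_trans _ Nc)// leq_exp2l.
Qed.

Lemma invariant_set_unbounded K c : X c -> exists2 d, K <= d & X d.
Proof.
move=> Xc; apply/not_exists2P => h.
have XK d : X d -> d < K by case: (h d) => [/negP|//]; rewrite -ltnNge.
pose s := [seq d <- iota 0 K | X d].
have sE d : (d \in s) = X d.
  by rewrite mem_filter mem_iota/= add0n andb_idr//; exact: XK.
(* A bounded invariant set falls under [doubling_size] with threshold 0, which forces it to be
   empty. *)
have : size s <= 2 * 0.
  apply: doubling_size sigI _ _; first by rewrite filter_uniq ?iota_uniq.
  by move=> j d; rewrite !sE X_sig.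
by move: Xc; rewrite -sE; case: (s).
Qed.

Lemma invariant_set_ancestor c : X c -> exists2 d, X d & 2 ^ (2 * N) <= d < 2 ^ (2 * N).+1.
Proof.
move=> /(invariant_set_unbounded (2 ^ (2 * N)))[d Nd Xd].
exists (ancestor (2 * N) d); last exact: ancestor_bounds.
have /andP[/splits_bound + _] := ancestor_bounds (2 * N) d.
apply: contraNT => Xa; apply/asboolP; exists (d %/ 2 ^ (2 * N)).-1.
by rewrite -cyl_ancestor// Xd (negbTE Xa).
Qed.

End invariant_set.

(** By [invariant_set_ancestor] every set meets the finite range of codes of level 2N, which is the
    same for all sets; the pigeonhole principle concludes. *)
Lemma no_disjoint_invariant_sets (X : nat -> pred nat) :
  (forall i, exists M, forall c m, M <= c -> X i (cyl c m) = X i c) ->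
  (forall i j c, X i (sig j c) = X i c) ->
  (forall i, exists c, X i c) ->
  (forall i j c, X i c -> X j c -> i = j) -> False.
Proof.
move=> Xcyl Xsig Xn0 Xdisj.
have /choice[f fP] i : exists d, X i d /\ 2 ^ (2 * N) <= d < 2 ^ (2 * N).+1.
  have [c Xc] := Xn0 i; have [M XM] := Xcyl i.
  by have [d] := invariant_set_ancestor XM (Xsig i) Xc; exists d.
have inj : injective f.
  by move=> i j ij; apply: (Xdisj _ _ (f i)); rewrite ?(fP i).1// ij (fP j).1.
pose K := 2 ^ (2 * N).+1.
have := @uniq_leq_size _ (map f (iota 0 K.+1)) (iota 0 K).
rewrite map_inj_uniq// iota_uniq size_map !size_iota ltnn => h.
suff : false by []; apply: h => // _ /mapP[i _ ->].
by rewrite mem_iota/= add0n; have [_ /andP[]] := fP i.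
Qed.

End disjoint_injections.
End cylinders.

(** * Clarkson's inequality for two complex numbers, with its equality case *)

Section clarkson.
Context {R : realType}.
Implicit Types (a b : R[i]) (q u v A B : R).

Lemma rnorm_parallelogram a b :
  rnorm (a + b) ^+ 2 + rnorm (a - b) ^+ 2 = 2 * (rnorm a ^+ 2 + rnorm b ^+ 2).
Proof.
apply: complexI; rewrite !(rmorphM, rmorphD, rmorph1)/= -!normE_rnorm.
by rewrite -!expr2 !normCK !(rmorphD, rmorphB)/=; ring.
Qed.

Lemma powR_midpoint q u v : 1 <= q -> 0 <= u -> 0 <= v ->
  2 * ((u + v) / 2) `^ q <= u `^ q + v `^ q.
Proof.
move=> q1 u0 v0.
have h : 0 <= 1 / 2 :> R by lra.
have h' : 1 / 2 <= 1 :> R by lra.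
have := @convex_powR R q q1 (Itv01 h h') u v.
rewrite !inE/= !in_itv/= !andbT => /(_ u0 v0).
rewrite !convRE/= => conv_le.
have : (1 / 2 * u + (1 - 1 / 2) * v) `^ q <=
  1 / 2 * u `^ q + (1 - 1 / 2) * v `^ q by exact: conv_le.
have -> : 1 / 2 * u + (1 - 1 / 2) * v = (u + v) / 2 by lra.
lra.
Qed.

(** In x^q = x * x^(q - 1) the second factor is strictly increasing. *)
Lemma powR_superadditive q A B : 1 < q -> 0 < A -> 0 < B ->
  A `^ q + B `^ q < (A + B) `^ q.
Proof.
move=> q1 A0 B0.
have powD x : 0 < x -> x `^ q = x * x `^ (q - 1).
  by move=> x0; rewrite -{2}(powRr1 (ltW x0)) -powRD ?subrKC ?(gt_eqF x0) ?implybT.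
have lt x y : 0 < x -> x < y -> x `^ (q - 1) < y `^ (q - 1).
  by move=> x0 xy; rewrite gt0_ltr_powR ?nnegrE ?subr_gt0// ltW// (lt_trans x0).
rewrite !powD ?addr_gt0// mulrDl ltrD// ltr_pM2l// lt//; lra.
Qed.

Lemma powR_superadditive_le q A B : 1 < q -> 0 <= A -> 0 <= B ->
  A `^ q + B `^ q <= (A + B) `^ q /\
  (A `^ q + B `^ q = (A + B) `^ q -> A = 0 \/ B = 0).
Proof.
move=> q1; have q0 : q != 0 by rewrite gt_eqF// (lt_trans _ q1).
rewrite !le_eqVlt => /predU1P[<-|A0].
  by rewrite powR0// !add0r eqxx; split=> //; left.
move=> /predU1P[<-|B0].
  by rewrite powR0// !addr0 eqxx; split=> //; right.
have lt := powR_superadditive q1 A0 B0.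
by rewrite lt orbT; split=> // eq; rewrite eq ltxx in lt.
Qed.

(** Meant for q = p / 2 and for the squared moduli [u], [v], [A], [B] of a + b, a - b, a, b, whose
    relation is the parallelogram identity. Convexity gives one half of the estimate;
    superadditivity gives the other half and the equality case. *)
Lemma clarkson_gt q u v A B : 1 < q -> 0 <= u -> 0 <= v -> 0 <= A -> 0 <= B ->
  u + v = 2 * (A + B) ->
  2 * (A `^ q + B `^ q) <= u `^ q + v `^ q /\
  (2 * (A `^ q + B `^ q) = u `^ q + v `^ q -> A = 0 \/ B = 0).
Proof.
move=> q1 u0 v0 A0 B0 uvAB.
have := powR_midpoint (ltW q1) u0 v0; rewrite uvAB (mulrC 2 (A + B)) mulfK// => mid.
have [le eq] := powR_superadditive_le q1 A0 B0.
by split=> [|e]; [|apply: eq]; lra.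
Qed.

(* powR_midpoint and powR_superadditive_le are applied to the exponent 1 / q > 1. *)
Lemma clarkson_lt q u v A B : 0 < q -> q < 1 ->
  0 <= u -> 0 <= v -> 0 <= A -> 0 <= B -> u + v = 2 * (A + B) ->
  u `^ q + v `^ q <= 2 * (A `^ q + B `^ q) /\
  (u `^ q + v `^ q = 2 * (A `^ q + B `^ q) -> A = 0 \/ B = 0).
Proof.
move=> q0 q1 u0 v0 A0 B0 uvAB.
have r1 : 1 < q^-1 by rewrite invf_gt1.
have powRK x : 0 <= x -> (x `^ q) `^ q^-1 = x.
  by move=> x0; rewrite -powRrM divff ?gt_eqF// powRr1.
have powVK x : 0 <= x -> (x `^ q^-1) `^ q = x.
  by move=> x0; rewrite -powRrM mulVf ?gt_eqF// powRr1.
have := powR_midpoint (ltW r1) (powR_ge0 u q) (powR_ge0 v q).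
rewrite !powRK// uvAB ler_pM2l// => mid.
have {}mid : (u `^ q + v `^ q) / 2 <= (A + B) `^ q.
  rewrite -[leLHS]powVK ?divr_ge0 ?addr_ge0 ?powR_ge0//.
  by rewrite ge0_ler_powR ?nnegrE ?powR_ge0 ?addr_ge0// ltW.
have [le eq] := powR_superadditive_le r1 (powR_ge0 A q) (powR_ge0 B q).
rewrite !powRK// in le eq.
have ABq : (A + B) `^ q <= A `^ q + B `^ q.
  rewrite -[leRHS]powVK ?addr_ge0 ?powR_ge0//.
  by rewrite ge0_ler_powR ?nnegrE ?powR_ge0 ?addr_ge0// ltW.
split=> [|e]; first lra.
have [] : A `^ q = 0 \/ B `^ q = 0.
- apply: eq; rewrite -{1}(powRK (A + B)) ?addr_ge0//; congr (_ `^ _); lra.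
- by move/eqP; rewrite powR_eq0 => /andP[/eqP]; left.
- by move/eqP; rewrite powR_eq0 => /andP[/eqP]; right.
Qed.

Definition clarkson_defect p a b : R :=
  (rnorm (a + b) `^ p + rnorm (a - b) `^ p) - 2 * (rnorm a `^ p + rnorm b `^ p).

Lemma clarkson p a b : 1 <= p -> p != 2 ->
  0 <= (-1) ^+ (p < 2)%R * clarkson_defect p a b /\
  (clarkson_defect p a b = 0 -> a = 0 \/ b = 0).
Proof.
move=> p1 p2.
have sq x : 0 <= x -> x `^ p = (x ^+ 2) `^ (p / 2).
  by move=> x0; rewrite -powR_mulrn// -powRrM mulrC divfK.
have par := rnorm_parallelogram a b.
have sq0 c : rnorm c ^+ 2 = 0 -> c = 0.
  by move/eqP; rewrite sqrf_eq0 => /eqP/rnorm_eq0.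
rewrite /clarkson_defect !sq ?rnorm_ge0//.
case: ltP => p2'.
  have q0 : 0 < p / 2 by lra.
  have q1 : p / 2 < 1 by lra.
  have [le eq] := clarkson_lt q0 q1 (sqr_ge0 _) (sqr_ge0 _) (sqr_ge0 _) (sqr_ge0 _) par.
  rewrite mulN1r; split; first lra.
  by move=> /subr0_eq/eq[/sq0|/sq0]; [left|right].
have q1 : 1 < p / 2 by rewrite ltr_pdivlMr// mul1r lt_neqAle eq_sym p2.
have [le eq] := clarkson_gt q1 (sqr_ge0 _) (sqr_ge0 _) (sqr_ge0 _) (sqr_ge0 _) par.
rewrite mul1r; split; first lra.
by move=> /subr0_eq/esym/eq[/sq0|/sq0]; [left|right].
Qed.

End clarkson.

(** * Lamperti's theorem on disjoint supports *)

Lemma esum_ge0_eq {R : realType} {I : choiceType} (f g : I -> R) :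
  (forall i, 0 <= f i) -> (forall i, f i <= g i) ->
  (\esum_(i in [set: I]) (f i)%:E)%E = (\esum_(i in [set: I]) (g i)%:E)%E ->
  (\esum_(i in [set: I]) (g i)%:E < +oo)%E -> f =1 g.
Proof.
move=> f0 fg fgE goo i.
have gfE : (\esum_(i in [set: I]) (g i)%:E =
    \esum_(i in [set: I]) (f i)%:E + \esum_(i in [set: I]) (g i - f i)%:E)%E.
  rewrite -esumD => [|j _|j _]; rewrite ?lee_fin ?subr_ge0//.
  by apply: eq_esum => j _; rewrite -EFinD subrKC.
have ffin : (\esum_(i in [set: I]) (f i)%:E)%E \is a fin_num.
  by rewrite ge0_fin_numE ?fgE// esum_ge0// => j _; rewrite lee_fin (le_trans (f0 j)).
have d0 : (\esum_(i in [set: I]) (g i - f i)%:E = 0)%E.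
  move: gfE ffin; rewrite -fgE; case: (esum _ _) => // r.
  by case: (esum _ _) => // d [/eqP]; rewrite addrC -subr_eq subrr => /eqP <-.
have := @esum_ge1 R I (fun i => (g i - f i)%:E) i.
rewrite d0 !lee_fin subr_ge0 => /(_ (fg i)); rewrite subr_le0 => gf.
by apply/le_anti; rewrite fg gf.
Qed.

Section lamperti.
Context {R : realType} {p : R} (p1 : 1 <= p) (p2 : p != 2).

Local Notation nrm := (@lpnorm R p _).

Lemma psum_lpnorm {I : choiceType} (x : lp p1 I) : psum p x = (nrm x `^ p)%:E.
Proof. exact: (psumE (lp_valP x)). Qed.

Definition disjoint_supports {I : choiceType} (x y : lp p1 I) :=
  forall i, x i = 0 \/ y i = 0.

(** This expresses disjointness by norms alone, which isometries preserve. Equality in the sum of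
    Clarkson's inequalities over all coordinates forces equality at each of them. *)
Lemma disjoint_supportsP {I : choiceType} (x y z w : lp p1 I) :
  (forall i, z i = x i + y i) -> (forall i, w i = x i - y i) ->
  disjoint_supports x y <->
  nrm z `^ p + nrm w `^ p = 2 * (nrm x `^ p + nrm y `^ p).
Proof.
move=> zE wE; have p0 : 0 < p by rewrite (lt_le_trans _ p1).
pose F i := rnorm (x i + y i) `^ p + rnorm (x i - y i) `^ p.
pose G i := 2 * (rnorm (x i) `^ p + rnorm (y i) `^ p).
have F0 i : 0 <= F i by rewrite addr_ge0 ?powR_ge0.
have G0 i : 0 <= G i by rewrite mulr_ge0// addr_ge0 ?powR_ge0.
have FE : ((nrm z `^ p + nrm w `^ p)%:E =
    \esum_(i in [set: I]) (F i)%:E)%E.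
  transitivity (psum p z + psum p w)%E; first by rewrite (psum_lpnorm z) (psum_lpnorm w).
  rewrite /psum -esumD; last 2 first.
  - by move=> i _; rewrite lee_fin powR_ge0.
  - by move=> i _; rewrite lee_fin powR_ge0.
  by apply: eq_esum => i _; rewrite -EFinD zE wE.
have GE : ((2 * (nrm x `^ p + nrm y `^ p))%:E =
    \esum_(i in [set: I]) (G i)%:E)%E.
  transitivity (2%:E * (psum p x + psum p y))%E.
    by rewrite (psum_lpnorm x) (psum_lpnorm y).
  rewrite /psum -esumD; last 2 first.
  - by move=> i _; rewrite lee_fin powR_ge0.
  - by move=> i _; rewrite lee_fin powR_ge0.
  by rewrite -esumZ// => i; rewrite adde_ge0// lee_fin powR_ge0.
split=> [xy|].
  move=> /=; apply: EFin_inj; rewrite FE GE; apply: eq_esum => i _.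
  rewrite /F /G; have [->|->] := xy i.
    by rewrite !add0r rnorm0 powR0 ?gt_eqF// /rnorm normrN add0r; congr EFin; lra.
  by rewrite !addr0 subr0 rnorm0 powR0 ?gt_eqF// addr0; congr EFin; lra.
move=> e; have FGE : (\esum_(i in [set: I]) (F i)%:E =
    \esum_(i in [set: I]) (G i)%:E)%E by exact: etrans (esym FE) (etrans (congr1 EFin e) GE).
have Foo : (\esum_(i in [set: I]) (F i)%:E < +oo)%E.
  by apply: (eq_ind _ (fun t => t < +oo)%E _ _ FE); exact: ltry.
have Goo : (\esum_(i in [set: I]) (G i)%:E < +oo)%E.
  by apply: (eq_ind _ (fun t => t < +oo)%E _ _ GE); exact: ltry.
have FG : F =1 G.
  (* The sign of the defect depends on [p] only, so one of [F] and [G] dominates the other at every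
     coordinate. *)
  case: (ltP p 2) (fun a b => @clarkson R p a b p1 p2) => /= p2' cl.
    apply: esum_ge0_eq => // i; have [+ _] := cl (x i) (y i).
    by rewrite mulN1r /clarkson_defect -/(F i) -/(G i) oppr_ge0 subr_le0.
  apply: fsym; apply: esum_ge0_eq => // i; have [+ _] := cl (x i) (y i).
  by rewrite mul1r /clarkson_defect -/(F i) -/(G i) subr_ge0.
move=> i; have [_ + ] := @clarkson R p (x i) (y i) p1 p2.
by apply; rewrite /clarkson_defect -/(F i) -/(G i) FG subrr.
Qed.

Lemma lamperti {I J : choiceType} (s : {linear lp p1 I -> lp p1 J}) :
  (forall x, nrm (s x) = nrm x) ->
  forall x y, disjoint_supports x y -> disjoint_supports (s x) (s y).
Proof.
move=> s_iso x y xy.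
apply/(@disjoint_supportsP _ _ _ (s (x + y)) (s (x - y))).
- by move=> i; rewrite linearD.
- by move=> i; rewrite linearB.
- by rewrite !s_iso; apply/disjoint_supportsP.
Qed.

End lamperti.

(** * Isometries on basis vectors, and hermitian idempotents *)

Section monomial.
Context {R : realType} {p : R} (p1 : 1 <= p).

Local Notation nrm := (@lpnorm R p _).

Section coordinates.
Context {I : choiceType}.
Implicit Types (x y : lp p1 I) (i k : I).

Lemma lp0E i : (0 : lp p1 I) i = 0. Proof. by []. Qed.
Lemma lpDE x y i : (x + y) i = x i + y i. Proof. by []. Qed.
Lemma lpNE x i : (- x) i = - x i. Proof. by []. Qed.
Lemma lpZE c x i : (c *: x) i = c * x i. Proof. by []. Qed.
Lemma deltaE k i : delta p1 k i = (i == k)%:R. Proof. by []. Qed.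

Lemma delta_neq0 k : delta p1 k <> 0.
Proof.
move=> /(congr1 (fun x : lp p1 I => x k)); rewrite deltaE lp0E eqxx.
by apply/eqP; rewrite oner_eq0.
Qed.

End coordinates.

Section isometries.
Hypothesis p2 : p != 2.
Context {I J : choiceType}.

Lemma isometry_eq0 (s : {linear lp p1 I -> lp p1 J}) z :
  (forall x, nrm (s x) = nrm x) -> s z = 0 -> z = 0.
Proof.
move=> s_iso sz; apply: lpnorm_eq0; rewrite -s_iso sz; exact: (rnorm0 (V := lp p1 J)).
Qed.

(** Split [z] into one nonzero coordinate [y] and the rest [x]. Their images have disjoint supports
    and add up to a basis vector, so one image vanishes; by injectivity it is that of [x]. *)
Lemma isometry_preimage_delta (s : {linear lp p1 I -> lp p1 J}) z k :
  (forall x, nrm (s x) = nrm x) -> s z = delta p1 k ->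
  exists c l, c != 0 /\ z = c *: delta p1 l.
Proof.
move=> s_iso szk.
have [l zl] : exists l, z l != 0.
  apply/not_existsP => z0; apply: (@delta_neq0 _ k); rewrite -szk.
  have -> : z = 0.
    by apply: lpP => i; apply/eqP/negPn/negP; exact: z0.
  exact: linear0.
exists (z l), l; split=> //.
pose y := z l *: delta p1 l; pose x := z - y.
have xy : disjoint_supports x y.
  move=> i; rewrite /x /y lpDE lpNE lpZE deltaE.
  by case: eqP => [->|_]; [left; rewrite mulr1 subrr|right; rewrite mulr0].
have sxy := lamperti p2 s_iso xy.
have sxyD i : s x i + s y i = (i == k)%:R.
  by rewrite -deltaE -szk -lpDE -linearD /x subrK.
have sxyN i : i != k -> s x i = 0 /\ s y i = 0.
  move=> /negbTE ik; have := sxyD i; rewrite ik.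
  by case: (sxy i) => ->; rewrite ?add0r ?addr0.
have sy0 : s y k <> 0.
  move=> syk; have : y = 0.
    apply: isometry_eq0 s_iso _; apply: lpP => i.
    by have [->|/sxyN[]] := eqVneq i k.
  move=> /(congr1 (fun x : lp p1 I => x l)); rewrite /y lpZE deltaE eqxx mulr1 lp0E.
  exact/eqP.
have : x = 0.
  apply: isometry_eq0 s_iso _; apply: lpP => i.
  by have [->|/sxyN[]//] := eqVneq i k; case: (sxy k).
by move/subr0_eq.
Qed.

End isometries.

Section diagonal.
Hypothesis p2 : p != 2.
Context {I : choiceType}.
Implicit Types (a b P : bop (lp p1 I)).

Lemma lpnorm_bop a (x : lp p1 I) : nrm (a x) <= opnorm a * nrm x.
Proof. exact: (le_opnorm a x). Qed.

Lemma contraction_lpnorm a (x : lp p1 I) : opnorm a <= 1 -> nrm (a x) <= nrm x.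
Proof.
move=> a1; apply: le_trans (lpnorm_bop a x) _.
by rewrite -[leRHS]mul1r ler_wpM2r ?lpnorm_ge0.
Qed.

Lemma contraction_isometry a b : opnorm a <= 1 -> opnorm b <= 1 ->
  (forall x, b (a x) = x) -> forall x : lp p1 I, nrm (a x) = nrm x.
Proof.
move=> a1 b1 ba x; have ax_le := contraction_lpnorm x a1.
have := contraction_lpnorm (a x) b1; rewrite ba => x_le.
exact: le_anti (introT andP (conj ax_le x_le)).
Qed.

(* With lam = -1, the vector (2P - 1) delta_n is a multiple c delta_l of a basis
   vector; if l <> n, then lam = i yields a vector with two nonzero coordinates,
   which the isometry P + i(1 - P) cannot produce. *)
Lemma hermitian_idempotent_diag P : (forall x, P (P x) = P x) ->
  (forall lam : R[i], rnorm lam = 1 -> opnorm (lam *: (1 - P) + P) <= 1) ->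
  forall n, P (delta p1 n) = delta p1 n \/ P (delta p1 n) = 0.
Proof.
move=> PP Pherm n.
pose U (lam : R[i]) : bop (lp p1 I) := lam *: (1 - P) + P.
have UE lam x : U lam x = lam *: (x - P x) + P x by [].
have UM lam mu x : U lam (U mu x) = U (lam * mu) x.
  have PU : P (U mu x) = P x.
    by rewrite [U mu x]UE linearP linearB/= PP subrr scaler0 add0r.
  by rewrite [LHS]UE PU !UE addrK scalerA.
have U1 x : U 1 x = x by rewrite UE scale1r subrK.
have Udelta lam : rnorm lam = 1 ->
    exists c l, c != 0 /\ U lam (delta p1 n) = c *: delta p1 l.
  move=> lam1; have lam0 : lam != 0.
    by apply/eqP => lam0; move: lam1; rewrite lam0 rnorm0 => /esym/eqP; rewrite oner_eq0.
  have lamV1 : rnorm lam^-1 = 1.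
    by have := rnormM lam lam^-1; rewrite divff// rnorm1 lam1 mul1r.
  have UV : U lam^-1 (U lam (delta p1 n)) = delta p1 n by rewrite UM mulVf// U1.
  (* [U lam] and [U lam^-1] are mutually inverse contractions, hence isometries, and the vector
     sought is the preimage of a basis vector under the latter. *)
  apply: (@isometry_preimage_delta p2 _ _ (U lam^-1) _ n _ UV).
  apply: (@contraction_isometry _ (U lam)); [exact: Pherm|exact: Pherm|].
  by move=> x; rewrite UM divff// U1.
pose J : R[i] := 'i%R.
have [|c [l [c0 Uc]]] := Udelta (-1).
  by rewrite /rnorm normrN normr1.
have [|d [m [d0 Ud]]] := Udelta J.
  by rewrite /rnorm /J normCi.
have Pc : P (delta p1 n) = 2^-1 *: (c *: delta p1 l + delta p1 n).
  apply: lpP => i; have := congr1 (fun x : lp p1 I => x i) Uc.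
  by rewrite UE !(lpDE, lpZE, lpNE) => <-; field.
(* If l = n, the basis vector is an eigenvector of the idempotent [P], with eigenvalue 0 or 1. *)
have [ln|ln] := eqVneq l n.
  have [e Pe] : exists e : R[i], P (delta p1 n) = e *: delta p1 n.
    exists (2^-1 * (c + 1)); rewrite Pc ln -scalerA scalerDl scale1r//.
  have := PP (delta p1 n); rewrite Pe linearZ/= Pe scalerA.
  move=> /(congr1 (fun x : lp p1 I => x n)); rewrite !lpZE deltaE eqxx !mulr1.
  move=> /eqP; rewrite -subr_eq0 -[X in _ - X]mulr1 -mulrBr mulf_eq0 subr_eq0.
  by case/orP => /eqP ->; [right; rewrite scale0r|left; rewrite scale1r].
have i2 (e : R[i]) : e = 1 \/ e = -1 -> e != J.
  move=> e1; apply/eqP => ei; have : e ^+ 2 = -1 by rewrite ei; exact: sqrCi.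
  have -> : e ^+ 2 = 1 by case: e1 => ->; rewrite ?sqrrN expr1n.
  by move/eqP; rewrite -subr_eq0 opprK (pnatr_eq0 _ 2).
have im0 : (1 - J) / 2 != 0 :> R[i].
  by rewrite mulf_neq0 ?invr_eq0 ?pnatr_eq0// subr_eq0 i2//; left.
have ip0 : (1 + J) / 2 != 0 :> R[i].
  by rewrite mulf_neq0 ?invr_eq0 ?pnatr_eq0// addrC -[1]opprK subr_eq0 eq_sym i2//; right.
have Udi i : U J (delta p1 n) i =
    (1 + J) / 2 * (i == n)%:R + (1 - J) / 2 * c * (i == l)%:R.
  by rewrite UE lpDE lpZE lpDE lpNE Pc lpZE lpDE lpZE !deltaE; field.
have nm : n = m.
  apply/eqP/negPn/negP => nm.
  have := Udi n; rewrite Ud lpZE deltaE (negbTE nm) eqxx [n == l]eq_sym (negbTE ln).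
  by rewrite !mulr0 addr0 mulr1 => /esym/eqP; rewrite (negbTE ip0).
have := Udi l; rewrite Ud -nm lpZE deltaE (negbTE ln) eqxx !mulr0 add0r mulr1.
by move=> /esym/eqP; rewrite mulf_eq0 (negbTE im0) (negbTE c0).
Qed.

End diagonal.
End monomial.

(** * Evaluation of operators and diagonal projections *)

Section bop_apply.
Context {R : realType} {E : normedModType R[i]}.
Implicit Types (a b : bop E) (x : E).

Lemma bopDE a b x : (a + b) x = a x + b x. Proof. by []. Qed.
Lemma bopNE a x : (- a) x = - a x. Proof. by []. Qed.
Lemma bopZE c a x : (c *: a) x = c *: a x. Proof. by []. Qed.
Lemma bopME a b x : (a * b) x = a (b x). Proof. by []. Qed.
Lemma bop1E x : (1 : bop E) x = x. Proof. by []. Qed.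

End bop_apply.

Section masks.
Context {R : realType} {p : R} (p1 : 1 <= p) {I : choiceType}.
Implicit Types (X Y : pred I) (x : lp p1 I).
Local Notation nrm := (@lpnorm R p _).

Definition maskop_fun X (x : I -> R[i]) i : R[i] := if X i then x i else 0.

Lemma psum_maskop X (x : I -> R[i]) : (psum p (maskop_fun X x) <= psum p x)%E.
Proof.
have p0 : p != 0 by rewrite gt_eqF// (lt_le_trans _ p1).
apply: le_esum => i _; rewrite /maskop_fun lee_fin; case: ifP => // _.
by rewrite rnorm0 powR0// powR_ge0.
Qed.

Lemma finite_maskop X x : finite_psum p1 (maskop_fun X x).
Proof. exact: le_lt_trans (psum_maskop X x) (lp_valP x). Qed.

Definition maskop_lp X x : lp p1 I := Lp (finite_maskop X x).

Lemma maskop_bounded X : maskop_lp X \in bounded_linear (lp p1 I).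
Proof.
apply: (@psum_bounded_linear _ _ _ _ _ 1) => // [c x y|x].
  apply: lpP => i; rewrite [RHS](_ : _ = c * maskop_fun X x i + maskop_fun X y i)//= /maskop_fun.
  by case: ifP => // _; rewrite mulr0 addr0.
by rewrite powR1 mul1e; exact: psum_maskop.
Qed.

Definition maskop X : bop (lp p1 I) := Bop (maskop_bounded X).

Lemma maskopE X x i : maskop X x i = if X i then x i else 0.
Proof. by []. Qed.

Lemma maskop_delta X k : maskop X (delta p1 k) = (X k)%:R *: delta p1 k.
Proof.
apply: lpP => i; rewrite maskopE lpZE deltaE.
by case: eqP => [->|_]; case: ifP => _; rewrite ?mulr0 ?mul1r ?mul0r.
Qed.

Lemma maskopM X Y : maskop X * maskop Y = maskop (predI X Y).
Proof.
apply: bopP => x; apply: lpP => i.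
rewrite maskopE [LHS](_ : _ = if X i then if Y i then x i else 0 else 0)//=.
by case: (X i).
Qed.

Lemma maskop0 : maskop pred0 = 0.
Proof. by apply: bopP => x; apply: lpP. Qed.

Lemma maskop_id X x : maskop X (maskop X x) = maskop X x.
Proof. by apply: lpP => i; rewrite !maskopE; case: (X i). Qed.

Lemma opnorm_lpnorm_le (a : bop (lp p1 I)) (M : R) : 0 <= M ->
  (forall x, nrm (a x) <= M * nrm x) -> opnorm a <= M.
Proof. by move=> M0 aM; apply: opnorm_le. Qed.

(** Every coordinate is multiplied by 1 or by [lam]. Contractive homomorphisms carry this bound over
    to the images of diagonal projections. *)
Lemma maskop_hermitian X (lam : R[i]) : rnorm lam = 1 ->
  opnorm (lam *: (1 - maskop X) + maskop X) <= 1.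
Proof.
move=> lam1; apply: opnorm_lpnorm_le => // x; rewrite mul1r.
have -> // : nrm ((lam *: (1 - maskop X) + maskop X : bop (lp p1 I)) x) = nrm x.
rewrite /lpnorm; congr (fine _ `^ _); apply: eq_esum => i _.
rewrite [X in rnorm X](_ : _ = lam * (x i - maskop X x i) + maskop X x i)// maskopE.
by case: ifP => _; rewrite ?subrr ?mulr0 ?add0r// subr0 addr0 rnormM lam1 mul1r.
Qed.

Lemma diag_maskop (P : bop (lp p1 I)) :
  (forall n, P (delta p1 n) = delta p1 n \/ P (delta p1 n) = 0) -> exists X, P = maskop X.
Proof.
move=> Pd; exists (fun n => `[< P (delta p1 n) = delta p1 n >]).
apply: bop_ext => k; rewrite maskop_delta; case: asboolP => [->|]; first by rewrite scale1r.
by case: (Pd k) => // ->; rewrite scale0r.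
Qed.

End masks.

(** * Elements of the Cuntz algebra and its unital contractive homomorphisms to itself *)

Section homomorphisms.
Context {R : realType} {p : R} {p1 : 1 <= p}.
Local Notation nrm := (@lpnorm R p _).
Local Notation O := (cuntz_alg p1).

Lemma cuntz_gen (a : bop (lp p1 nat)) :
  [set opS p1 false; opT p1 false; opS p1 true; opT p1 true] a -> O a.
Proof. by move=> aG A [_ AG]; exact: AG. Qed.

Lemma cuntz_S j : O (opS p1 j).
Proof. by apply: cuntz_gen; case: j => /=; tauto. Qed.

Lemma cuntz_T j : O (opT p1 j).
Proof. by apply: cuntz_gen; case: j => /=; tauto. Qed.

Lemma cuntz_mul a b : O a -> O b -> O (a * b).
Proof.
move=> Oa Ob A HA; have [[_ _ AM] _] := HA.
by apply: AM; [exact: Oa|exact: Ob].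
Qed.

Lemma cuntz_lin (c : R[i]) a b : O a -> O b -> O (c *: a + b).
Proof.
move=> Oa Ob A HA; have [[_ [_ AL] _] _] := HA.
by apply: AL; [exact: Oa|exact: Ob].
Qed.

Lemma opTS j (x : lp p1 nat) : opT p1 j (opS p1 j x) = x.
Proof.
apply: lpP => n /=; rewrite /Tfun /= /Sfun half_bit_double oddD odd_double addbF.
by rewrite oddb eqxx.
Qed.

Lemma opSTE j (x : lp p1 nat) n : opS p1 j (opT p1 j x) n = if odd n == j then x n else 0.
Proof.
rewrite /= /Sfun; case: eqP => //= nj; rewrite /Tfun.
by rewrite -{2}(odd_double_half n) nj.
Qed.

Lemma opS_maskop_opT j (X : pred nat) :
  opS p1 j * maskop p1 X * opT p1 j = maskop p1 (fun n => (odd n == j) && X n./2).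
Proof.
apply: bopP => x; apply: lpP => n.
rewrite maskopE [LHS](_ : _ = opS p1 j (maskop p1 X (opT p1 j x)) n)//= /Sfun /= /maskop_fun.
case: eqP => //= nj; case: ifP => //= _; rewrite /Tfun.
by rewrite -{2}(odd_double_half n) nj.
Qed.

Lemma opnorm_S j : opnorm (opS p1 j) <= 1.
Proof.
apply: opnorm_lpnorm_le => // x; rewrite mul1r.
by have -> : nrm (opS p1 j x) = nrm x by rewrite /lpnorm psum_Sfun.
Qed.

Lemma opnorm_T j : opnorm (opT p1 j) <= 1.
Proof.
apply: opnorm_lpnorm_le => // x; rewrite mul1r.
apply: (lpnorm_le p1); first exact: lpnorm_ge0.
by rewrite -psum_lpnorm; exact: psum_Tfun.
Qed.

End homomorphisms.

Section cuntz_homomorphisms.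
Context {R : realType} {p : R} {p1 : 1 <= p} (p2 : p != 2).
Local Notation nrm := (@lpnorm R p _).
Local Notation O := (cuntz_alg p1).
Variable chi : bop (lp p1 nat) -> bop (lp p1 nat).
Hypothesis chi_hom : unital_contractive_hom O O chi.

Lemma hom_opnorm a : O a -> opnorm (chi a) <= opnorm a.
Proof.
by have [_ _ _ _ le] := chi_hom => /le; rewrite !normE_rnorm lecR.
Qed.

Lemma hom1 : chi 1 = 1. Proof. by have [] := chi_hom. Qed.

Lemma homM a b : O a -> O b -> chi (a * b) = chi a * chi b.
Proof. by have [_ _ M _ _] := chi_hom; exact: M. Qed.

Lemma homL (c : R[i]) a b : O a -> O b -> chi (c *: a + b) = c *: chi a + chi b.
Proof. by have [_ L _ _ _] := chi_hom; exact: L. Qed.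

Lemma hom0 : chi 0 = 0.
Proof.
have := @homL (-1) 1 1 (@cuntz_alg1 _ _ p1) (@cuntz_alg1 _ _ p1).
by rewrite !scaleN1r !addNr.
Qed.

(** The image is an idempotent that inherits the bound of [maskop_hermitian], so
    [hermitian_idempotent_diag] applies. *)
Lemma hom_maskop (X : pred nat) : O (maskop p1 X) -> exists Y, chi (maskop p1 X) = maskop p1 Y.
Proof.
move=> OX; apply: diag_maskop; apply: (hermitian_idempotent_diag p2).
  move=> x; rewrite [LHS](_ : _ = (chi (maskop p1 X) * chi (maskop p1 X)) x)//.
  rewrite -homM// (_ : maskop p1 X * maskop p1 X = maskop p1 X)//.
  by apply: bopP => y; exact: maskop_id.
move=> lam lam1.
have O1X : O (1 - maskop p1 X).
  by rewrite addrC -scaleN1r; apply: cuntz_lin => //; exact: (@cuntz_alg1 _ _ p1).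
have -> : lam *: (1 - chi (maskop p1 X)) + chi (maskop p1 X) =
    chi (lam *: (1 - maskop p1 X) + maskop p1 X).
  rewrite homL//; congr (_ *: _ + _).
  have -> : 1 - maskop p1 X = (-1) *: maskop p1 X + 1 by rewrite scaleN1r addrC.
  rewrite homL ?hom1//; last exact: (@cuntz_alg1 _ _ p1).
  by rewrite scaleN1r addrC.
apply: le_trans (maskop_hermitian p1 X lam1).
by apply: hom_opnorm; exact: cuntz_lin.
Qed.

Lemma hom_TS j x : chi (opT p1 j) (chi (opS p1 j) x) = x.
Proof.
rewrite [LHS](_ : _ = (chi (opT p1 j) * chi (opS p1 j)) x)//.
rewrite -homM; [|exact: cuntz_T|exact: cuntz_S].
rewrite (_ : _ * _ = 1) ?hom1//.
by apply: bopP => y; exact: opTS.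
Qed.

Lemma hom_S_isometry j (x : lp p1 nat) : nrm (chi (opS p1 j) x) = nrm x.
Proof.
apply: contraction_isometry (hom_TS j) x.
  apply: le_trans (hom_opnorm _) (opnorm_S j); exact: cuntz_S.
apply: le_trans (hom_opnorm _) (opnorm_T j); exact: cuntz_T.
Qed.

(** The two range projections add up to 1, so their images are complementary masks; one Boolean
    function [X] records in which range each basis vector lies. *)
Lemma hom_ST : exists X : pred nat, forall j x,
  chi (opS p1 j) (chi (opT p1 j) x) = maskop p1 (fun n => X n == j) x.
Proof.
have opST j : opS p1 j * opT p1 j = maskop p1 (fun n => odd n == j).
  by apply: bopP => x; apply: lpP => n; rewrite maskopE -opSTE.
have OST j : O (maskop p1 (fun n => odd n == j)).
  by rewrite -opST; apply: cuntz_mul; [exact: cuntz_S|exact: cuntz_T].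
have chiST j x : chi (opS p1 j) (chi (opT p1 j) x) =
    chi (maskop p1 (fun n => odd n == j)) x.
  by rewrite -opST homM//; [exact: cuntz_S|exact: cuntz_T].
have [X XE] := hom_maskop (OST true); exists X => -[] x; rewrite chiST.
  by rewrite XE (_ : (fun n => X n == true) = X)//; apply/funext => n; case: (X n).
have -> : maskop p1 (fun n => odd n == false) = (-1) *: maskop p1 (fun n => odd n == true) + 1.
  apply: bopP => y; apply: lpP => n.
  rewrite bopDE bopZE bop1E lpDE lpZE !maskopE.
  by case: (odd n); rewrite /= mulN1r ?oppr0 ?addNr ?add0r.
rewrite homL ?hom1 ?XE//; last exact: (@cuntz_alg1 _ _ p1).
apply: lpP => n; rewrite bopDE bopZE bop1E lpDE lpZE !maskopE.
by case: (X n); rewrite /= mulN1r ?oppr0 ?addNr ?add0r.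
Qed.

Lemma hom_S_delta : exists (sig : bool -> nat -> nat) (c : bool -> nat -> R[i]),
  jointly_injective sig /\ forall j n, c j n != 0 /\
    chi (opS p1 j) (delta p1 n) = c j n *: delta p1 (sig j n).
Proof.
have [X chiST] := hom_ST.
have preim k : exists c l, c != 0 /\ delta p1 k = c *: chi (opS p1 (X k)) (delta p1 l).
  have STk : chi (opS p1 (X k)) (chi (opT p1 (X k)) (delta p1 k)) = delta p1 k.
    by rewrite chiST maskop_delta eqxx scale1r.
  have [c [l [c0 Tk]]] := isometry_preimage_delta p2 (@hom_S_isometry (X k)) STk.
  by exists c, l; split=> //; rewrite -[LHS]STk Tk linearZ.
have im j n : exists k (c : R[i]), [/\ c != 0, X k = j &
    chi (opS p1 j) (delta p1 n) = c *: delta p1 k].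
  have [k k0] : exists k, chi (opS p1 j) (delta p1 n) k != 0.
    apply/not_existsP => s0; apply: (@delta_neq0 _ _ p1 _ n).
    rewrite -(hom_TS j (delta p1 n)).
    have -> : chi (opS p1 j) (delta p1 n) = 0; last exact: linear0.
    by apply: lpP => i; apply/eqP/negPn/negP; exact: s0.
  have Xk : X k = j.
    move: k0; rewrite -{1}(hom_TS j (delta p1 n)) chiST maskopE.
    by case: (X k =P j) => //; rewrite eqxx.
  have [c [l [c0 kE]]] := preim k; rewrite Xk in kE.
  (* If l <> n, the images of the basis vectors at [l] and [n] have disjoint supports by [lamperti],
     yet both are nonzero at [k]. *)
  have [ln|ln] := eqVneq l n.
    exists k, c^-1; split; rewrite ?invr_eq0//.
    by rewrite kE ln scalerA mulVf// scale1r.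
  have dis : disjoint_supports (chi (opS p1 j) (delta p1 n))
      (chi (opS p1 j) (delta p1 l)).
    apply: (lamperti p2 (@hom_S_isometry j)) => i; rewrite !deltaE.
    by have [->|_] := eqVneq i n; [right; rewrite eq_sym (negbTE ln)|left].
  have [/eqP|sl] := dis k; first by rewrite (negbTE k0).
  have := congr1 (fun x : lp p1 nat => x k) kE.
  rewrite deltaE eqxx lpZE sl mulr0 => /eqP; by rewrite oner_eq0.
have /choice[sig /choice[c sc]] : forall jn, exists k (c : R[i]), [/\ c != 0, X k = jn.1 &
    chi (opS p1 jn.1) (delta p1 jn.2) = c *: delta p1 k].
  by move=> [j n]; exact: im.
exists (fun j n => sig (j, n)), (fun j n => c (j, n)); split; last first.
  by move=> j n; have [] := sc (j, n).
move=> j k m n jk; have /= [cj0 Xj cj] := sc (j, m); have /= [ck0 Xk ck] := sc (k, n).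
have jk' : j = k by rewrite -Xj -Xk jk.
split=> //; subst k; rewrite -jk in ck.
(* The left inverse [chi (opT p1 j)], applied to two multiples of one basis vector, shows that those
   at [m] and [n] are proportional. *)
have : c (j, n) *: delta p1 m = c (j, m) *: delta p1 n.
  rewrite -(hom_TS j (delta p1 m)) -(hom_TS j (delta p1 n)) cj ck -!linearZ/= !scalerA.
  by rewrite mulrC.
move=> /(congr1 (fun x : lp p1 nat => x m)); rewrite !lpZE !deltaE eqxx mulr1.
by case: eqP => // _; rewrite mulr0 => /eqP; rewrite (negbTE ck0).
Qed.

End cuntz_homomorphisms.

(** * Norm closures of algebras of operators *)

Section closures.
Context {R : realType} {E : normedModType R[i]}.
Implicit Types (a b : bop E) (A G : set (bop E)).

Lemma closure_bopP A a :
  closure A a <-> forall e : R, 0 < e -> exists2 b, A b & opnorm (a - b) < e.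
Proof.
split=> [aA e e0|aA B /nbhs_ballP[e /= e0 eB]].
  have : nbhs a (ball a e%:C) by apply: nbhsx_ballx; rewrite (ltcR 0).
  move=> /aA[b [Ab]]; rewrite -ball_normE /= normE_rnorm ltcR => ab.
  by exists b.
have [r [r0 re]] : exists r : R, 0 < r /\ r%:C = e.
  exists (complex.Re e); have ere : (complex.Re e)%:C = e by rewrite RRe_real// gtr0_real.
  by split=> //; rewrite -(ltcR 0) ere.
have [b Ab ab] := aA _ r0; exists b; split=> //; apply: eB.
by rewrite -ball_normE /= normE_rnorm -re ltcR.
Qed.

Lemma opnormM a b : opnorm (a * b) <= opnorm a * opnorm b.
Proof.
apply: opnorm_le; first by rewrite mulr_ge0 ?opnorm_ge0.
move=> x; apply: le_trans (le_opnorm a (b x)) _.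
rewrite -mulrA; apply: ler_wpM2l; first exact: opnorm_ge0.
exact: le_opnorm.
Qed.

Lemma linear_subspace_span G : linear_subspace (linear_span G).
Proof.
split=> [A [[A0 _] _]//|c a b Ga Gb A HA].
have [[_ AL] _] := HA; apply: AL; [exact: Ga|exact: Gb].
Qed.

(** The minimality of the span is used twice: in the left factor with a generator on the right, then
    in the right factor. *)
Lemma span_mul G : (forall a b, G a -> G b -> G (a * b)) ->
  forall a b, linear_span G a -> linear_span G b -> linear_span G (a * b).
Proof.
move=> GM; have [L0 LL] := linear_subspace_span G.
have L_G a b : linear_span G a -> G b -> linear_span G (a * b).
  move=> Ga Gb; apply: (Ga (fun a => linear_span G (a * b))); split; [split|].
  - by rewrite mul0r.
  - move=> c x y xb yb; rewrite (_ : _ * b = c *: (x * b) + y * b); first exact: LL.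
    exact: bopP.
  - by move=> x Gx; apply: sub_gen_smallest; exact: GM.
move=> a b Ga Gb; apply: (Gb (fun b => linear_span G (a * b))); split; [split|].
- by rewrite mulr0.
- move=> c x y ax ay; rewrite (_ : a * _ = c *: (a * x) + a * y); first exact: LL.
  by apply: bopP => z; rewrite bopME bopDE bopZE linearP.
- by move=> x Gx; exact: L_G.
Qed.

Lemma closed_subalgebra_closure A : linear_subspace A ->
  (forall a b, A a -> A b -> A (a * b)) -> closed_subalgebra (closure A).
Proof.
move=> [A0 AL] AM; split; first exact: closed_closure.
  split; first exact: subset_closure.
  move=> c a b /closure_bopP aA /closure_bopP bA; apply/closure_bopP => e e0.
  have c1 : 0 < rnorm c + 1 by rewrite ltr_wpDl ?rnorm_ge0.
  have [|a' Aa' aa'] := aA (e / 2 / (rnorm c + 1)); first by rewrite !divr_gt0.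
  have [|b' Ab' bb'] := bA (e / 2); first by rewrite divr_gt0.
  exists (c *: a' + b'); first exact: AL.
  have -> : c *: a + b - (c *: a' + b') = c *: (a - a') + (b - b').
    by rewrite scalerBr opprD addrACA.
  apply: le_lt_trans (opnormD _ _) _; rewrite opnormZ [e]splitr.
  apply: ler_ltD bb'.
  apply: (@le_trans _ _ ((rnorm c + 1) * (e / 2 / (rnorm c + 1)))).
    apply: ler_pM => //; rewrite ?rnorm_ge0 ?opnorm_ge0 ?lerDl//.
    exact: ltW.
  by rewrite mulrC divfK// gt_eqF.
move=> a b /closure_bopP aA /closure_bopP bA; apply/closure_bopP => e e0.
have b1 : 0 < opnorm b + 1 by rewrite ltr_wpDl ?opnorm_ge0.
(* The tolerance for [b'] involves the norm of [a'], so [a'] is chosen first. Adding 1 to a norm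
   keeps the denominator positive. *)
have [|a' Aa' aa'] := aA (e / 2 / (opnorm b + 1)); first by rewrite !divr_gt0.
have a1 : 0 < opnorm a' + 1 by rewrite ltr_wpDl ?opnorm_ge0.
have [|b' Ab' bb'] := bA (e / 2 / (opnorm a' + 1)); first by rewrite !divr_gt0.
exists (a' * b'); first exact: AM.
have -> : a * b - a' * b' = (a - a') * b + a' * (b - b').
  by rewrite mulrBl mulrBr addrA subrK.
have small u v w : 0 <= u -> 0 <= v -> v < e / 2 / (u + 1) -> w <= u * v -> w < e / 2.
  move=> u0 v0 vlt wle; apply: le_lt_trans wle _.
  have u1 : 0 < u + 1 by rewrite ltr_wpDl.
  rewrite ltr_pdivlMr// in vlt; apply: le_lt_trans vlt.
  by rewrite mulrC ler_wpM2l// lerDl.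
apply: le_lt_trans (opnormD _ _) _; rewrite [e]splitr; apply: ltrD.
  apply: (small (opnorm b) (opnorm (a - a'))); rewrite ?opnorm_ge0//.
  by rewrite mulrC; exact: opnormM.
apply: (small (opnorm a') (opnorm (b - b'))); rewrite ?opnorm_ge0//.
exact: opnormM.
Qed.

End closures.

(** * The action of the Cuntz algebra on cylinders *)

Section cylinder_structure.
Context {R : realType} {p : R} (p1 : 1 <= p).
Local Notation nrm := (@lpnorm R p _).

(** The arbitrary lower bound [D] on the codes of the images is what makes the property stable under
    products. *)
Definition cyl_to_cyl (a : bop (lp p1 nat)) := forall D, exists N, forall c, (N <= c)%N ->
  (forall m, a (delta p1 (cyl c m)) = 0) \/
  exists2 d, (D <= d)%N & forall m, a (delta p1 (cyl c m)) = delta p1 (cyl d m).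

Lemma cyl_to_cyl_S j : cyl_to_cyl (opS p1 j).
Proof.
move=> D; exists D.+1 => c Dc; right; exists (2 * c + j)%N; first by lia.
by move=> m; rewrite opS_delta cyl_double//; lia.
Qed.

Lemma cyl_to_cyl_T j : cyl_to_cyl (opT p1 j).
Proof.
(* From this bound on, [c./2] is at least [D] and also positive, as [cyl_double] requires. *)
move=> D; exists (D.*2.+2)%N => c Dc.
have cE : c = (2 * c./2 + odd c)%N by rewrite mul2n addnC odd_double_half.
have cm m : cyl c m = (2 * cyl c./2 m + odd c)%N.
  by rewrite {1}cE cyl_double//; lia.
have [cj|cj] := eqVneq (odd c) j; [right|left] => [|m].
  by exists c./2; [lia|move=> m; rewrite cm cj opT_delta].
apply: opT_delta0 => l; rewrite cm => e; move/eqP: cj; apply.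
by have := congr1 odd e; rewrite !mul2n !oddD !odd_double !addFb !oddb.
Qed.

Lemma cyl_to_cylM a b : cyl_to_cyl a -> cyl_to_cyl b -> cyl_to_cyl (a * b).
Proof.
move=> Ha Hb D; have [M HM] := Ha D; have [N HN] := Hb M; exists N => c Nc.
have [b0|[d Md bd]] := HN c Nc.
  by left=> m; rewrite bopME b0 linear0.
have [a0|[d' Dd' ad]] := HM d Md.
  by left=> m; rewrite bopME bd a0.
by right; exists d' => // m; rewrite bopME bd ad.
Qed.

(** A linear condition on matrix entries, so that it passes from [cyl_to_cyl] operators to their
    span. Row 0 is treated apart because 0 is not a genuine code. *)
Definition cyl_stable (a : bop (lp p1 nat)) := exists N, forall c, (N <= c)%N ->
  a (delta p1 c) 0%N = 0 /\
  forall m d, (0 < d)%N -> a (delta p1 (cyl c m)) (cyl d m) = a (delta p1 c) d.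

Lemma cyl_to_cyl_stable a : cyl_to_cyl a -> cyl_stable a.
Proof.
(* Taking [D] to be 1 makes the code [d] positive, as [cyl_inj] requires. *)
move=> /(_ 1%N)[N HN]; exists N => c /HN[a0|[d d0 ad]].
  have a0c : a (delta p1 c) = 0 by rewrite -{1}(cyl0 c) a0.
  by rewrite a0c; split=> // m d _; rewrite a0.
have adc : a (delta p1 c) = delta p1 d by rewrite -{1}(cyl0 c) ad cyl0.
rewrite adc; split=> [|m k k0]; first by rewrite deltaE; case: d d0 {ad adc}.
rewrite ad !deltaE; congr (nat_of_bool _)%:R; apply/eqP/eqP => [|->//].
exact: cyl_inj.
Qed.

Lemma cyl_stable_subspace : linear_subspace cyl_stable.
Proof.
split; first by exists 0%N => c _; split=> // m d _.
move=> k a b [M HM] [N HN]; exists (maxn M N) => c; rewrite geq_max => /andP[Mc Nc].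
have [a0 am] := HM c Mc; have [b0 bm] := HN c Nc.
split; first by rewrite bopDE bopZE lpDE lpZE a0 b0 mulr0 addr0.
by move=> m d d0; rewrite !bopDE !bopZE !lpDE !lpZE am// bm.
Qed.

(** The closure of the span of the [cyl_to_cyl] operators is a closed subalgebra containing the
    generators. *)
Lemma cuntz_approx a e : cuntz_alg p1 a -> 0 < e ->
  exists2 b, cyl_stable b & opnorm (a - b) < e.
Proof.
move=> Oa e0; have alg : closed_subalgebra (closure (linear_span cyl_to_cyl)).
  apply: closed_subalgebra_closure; first exact: linear_subspace_span.
  by apply: span_mul; exact: cyl_to_cylM.
have gen : [set opS p1 false; opT p1 false; opS p1 true; opT p1 true] `<=`
    closure (linear_span cyl_to_cyl).
  move=> x xG; apply: subset_closure; apply: sub_gen_smallest.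
  case: xG => [[[|]|]|] ->; do ?[exact: cyl_to_cyl_S|exact: cyl_to_cyl_T].
have /closure_bopP/(_ e e0)[b Wb ab] := Oa _ (conj alg gen).
exists b => //; apply: Wb; split; first exact: cyl_stable_subspace.
exact: cyl_to_cyl_stable.
Qed.

Lemma coord_le (x : lp p1 nat) i : rnorm (x i) <= nrm x.
Proof.
have p0 : 0 < p by rewrite (lt_le_trans _ p1).
have := le_psum p x i; rewrite psum_lpnorm lee_fin.
apply: contraTT; rewrite -!ltNge => lt.
by rewrite gt0_ltr_powR ?nnegrE ?lpnorm_ge0 ?rnorm_ge0.
Qed.

Lemma lpnorm_delta (k : nat) : nrm (delta p1 k) = 1.
Proof. by rewrite /lpnorm psum_deltaE ?powR1. Qed.

Lemma bop_coord_le (a : bop (lp p1 nat)) k i : rnorm (a (delta p1 k) i) <= opnorm a.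
Proof.
apply: le_trans (coord_le _ _) _; apply: le_trans (lpnorm_bop _ _) _.
by rewrite lpnorm_delta mulr1.
Qed.

Lemma cuntz_cyl a e : cuntz_alg p1 a -> 0 < e -> exists N, forall c, (N <= c)%N ->
  rnorm (a (delta p1 c) 0%N) < e /\ forall m d, (0 < d)%N ->
    rnorm (a (delta p1 (cyl c m)) (cyl d m) - a (delta p1 c) d) < e.
Proof.
move=> Oa e0; have [|b [N bN] ab] := cuntz_approx Oa (_ : 0 < e / 2).
  by rewrite divr_gt0.
have near k i : rnorm (a (delta p1 k) i - b (delta p1 k) i) < e / 2.
  have := bop_coord_le (a - b) k i; rewrite bopDE bopNE lpDE lpNE => le.
  exact: le_lt_trans le ab.
exists N => c /bN[b0 bm]; split=> [|m d /bm bmd].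
  by have := near c 0%N; rewrite b0 subr0; lra.
have -> : a (delta p1 (cyl c m)) (cyl d m) - a (delta p1 c) d =
    (a (delta p1 (cyl c m)) (cyl d m) - b (delta p1 (cyl c m)) (cyl d m))
    + - (a (delta p1 c) d - b (delta p1 c) d).
  by rewrite bmd; ring.
apply: le_lt_trans (rnormD _ _) _; rewrite [e]splitr; apply: ltrD; first exact: near.
have := near c d; rewrite /rnorm normrN; exact.
Qed.

End cylinder_structure.

(** * Elementary tensors and the two commuting homomorphisms *)

Section tensor_factors.
Context {R : realType} {p : R} {p1 : 1 <= p} {I J : choiceType}.
Implicit Types (a : bop (lp p1 I)) (b : bop (lp p1 J)).

Lemma tensopM a a' b b' : tensop a b * tensop a' b' = tensop (a * a') (b * b').
Proof.
apply: tensop_uniq => x y.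
have := congr1 (tensop a b) (tensopE a' b' x y). rewrite (tensopE a b (a' x) (b' y)).
exact.
Qed.

Lemma tensop11 : tensop (1 : bop (lp p1 I)) (1 : bop (lp p1 J)) = 1.
Proof. exact/esym/tensop_uniq. Qed.

Lemma tensvE (x : lp p1 I) (y : lp p1 J) i j : tensv x y (i, j) = x i * y j.
Proof. by []. Qed.

Lemma tensopLl c a a' b : tensop (c *: a + a') b = c *: tensop a b + tensop a' b.
Proof.
apply/esym/tensop_uniq => x y; rewrite bopDE bopZE !tensopE.
apply: lpP => -[i j]; rewrite lpDE lpZE !tensvE bopDE bopZE lpDE lpZE.
by rewrite mulrDl mulrA.
Qed.

Lemma tensopLr c a b b' : tensop a (c *: b + b') = c *: tensop a b + tensop a b'.
Proof.
apply/esym/tensop_uniq => x y; rewrite bopDE bopZE !tensopE.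
apply: lpP => -[i j]; rewrite lpDE lpZE !tensvE bopDE bopZE lpDE lpZE.
by rewrite mulrDr mulrCA.
Qed.

Lemma opnorm_psum_le (K : choiceType) (a : bop (lp p1 K)) (M : R) : 0 <= M ->
  (forall x : lp p1 K, (psum p (a x) <= (M `^ p)%:E * psum p x)%E) -> opnorm a <= M.
Proof. by move=> M0 aM; apply: opnorm_le => // x; exact: psum_bound. Qed.

Lemma opnorm_tensl a : opnorm (tensop a (1 : bop (lp p1 J))) <= opnorm a.
Proof.
apply: opnorm_psum_le; first exact: opnorm_ge0.
move=> z; rewrite !psum_prodEr -esumZ ?powR_ge0//; last by move=> *; exact: psum_ge0.
apply: le_esum => j _; have := psum_bop a (col_lp z j).
rewrite [X in (psum p X <= _)%E -> _](_ : _ = (fun i => tensop a (1 : bop (lp p1 J)) z (i, j)))//.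
apply/funext => i; rewrite [RHS](_ : _ = a (col_lp (ampr 1 z) j) i)//.
by congr (a _ i); apply: lpP.
Qed.

Lemma opnorm_tensr b : opnorm (tensop (1 : bop (lp p1 I)) b) <= opnorm b.
Proof.
apply: opnorm_psum_le; first exact: opnorm_ge0.
move=> z; rewrite !psum_prodE -esumZ ?powR_ge0//; last by move=> *; exact: psum_ge0.
by apply: le_esum => i _; exact: (psum_bop b (row_lp z i)).
Qed.

End tensor_factors.

Section factors.
Context {R : realType} {p : R} {p1 : 1 <= p}.
Local Notation O := (cuntz_alg p1).
Variable phi : bop (lp p1 (nat * nat)%type) -> bop (lp p1 nat).
Hypothesis phi_hom : unital_contractive_hom (spatial_tensor O O) O phi.

Lemma spatial_tensop a b : O a -> O b -> spatial_tensor O O (tensop a b).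
Proof.
move=> Oa Ob; apply: subset_closure; apply: sub_gen_smallest.
by exists a => //; exists b.
Qed.

Let O1 : O 1 := @cuntz_alg1 _ _ p1.

Lemma hom_left : unital_contractive_hom O O (fun a => phi (tensop a 1)).
Proof.
have [phiO phiL phiM phi1 phi_le] := phi_hom; split.
- by move=> a Oa; apply: phiO; exact: spatial_tensop.
- by move=> c a b Oa Ob; rewrite tensopLl phiL//; exact: spatial_tensop.
- move=> a b Oa Ob; rewrite -phiM; [|exact: spatial_tensop|exact: spatial_tensop].
  by rewrite tensopM mulr1.
- by rewrite tensop11.
- move=> a Oa; apply: le_trans (phi_le _ _) _; first exact: spatial_tensop.
  rewrite !normE_rnorm lecR; exact: opnorm_tensl.
Qed.

Lemma hom_right : unital_contractive_hom O O (fun b => phi (tensop 1 b)).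
Proof.
have [phiO phiL phiM phi1 phi_le] := phi_hom; split.
- by move=> b Ob; apply: phiO; exact: spatial_tensop.
- by move=> c a b Oa Ob; rewrite tensopLr phiL//; exact: spatial_tensop.
- move=> a b Oa Ob; rewrite -phiM; [|exact: spatial_tensop|exact: spatial_tensop].
  by rewrite tensopM mulr1.
- by rewrite tensop11.
- move=> b Ob; apply: le_trans (phi_le _ _) _; first exact: spatial_tensop.
  rewrite !normE_rnorm lecR; exact: opnorm_tensr.
Qed.

Lemma hom_commute a b : O a -> O b ->
  phi (tensop a 1) * phi (tensop 1 b) = phi (tensop 1 b) * phi (tensop a 1).
Proof.
move=> Oa Ob; have [_ _ phiM _ _] := phi_hom.
rewrite -!phiM ?tensopM ?mulr1 ?mul1r//; exact: spatial_tensop.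
Qed.

End factors.

(** * Infinitely many orthogonal full projections in the Cuntz algebra *)

Section odd_sets.
Context {R : realType} {p : R} {p1 : 1 <= p}.
Local Notation O := (cuntz_alg p1).

(* pow2_odd i is the set of the numbers 2 ^ i * n with n odd. *)
Fixpoint pow2_odd (i : nat) : pred nat :=
  if i is i'.+1 then fun n => (odd n == false) && pow2_odd i' n./2
  else fun n => odd n.

Lemma pow2_odd_disjoint i j n : pow2_odd i n -> pow2_odd j n -> i = j.
Proof.
elim: i j n => [|i IH] [|j] n //=; case: (odd n) => //= ni nj.
by rewrite (IH _ _ ni nj).
Qed.

Lemma maskop_odd : maskop p1 (pow2_odd 0) = opS p1 true * opT p1 true.
Proof.
by apply: bopP => x; apply: lpP => n; rewrite maskopE bopME opSTE /=; case: (odd n).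
Qed.

Lemma maskop_pow2_oddS i :
  maskop p1 (pow2_odd i.+1) = opS p1 false * maskop p1 (pow2_odd i) * opT p1 false.
Proof. by rewrite opS_maskop_opT. Qed.

Lemma cuntz_maskop_pow2_odd i : O (maskop p1 (pow2_odd i)).
Proof.
elim: i => [|i IH]; first by rewrite maskop_odd; apply: cuntz_mul;
  [exact: cuntz_S|exact: cuntz_T].
rewrite maskop_pow2_oddS; apply: cuntz_mul; last exact: cuntz_T.
by apply: cuntz_mul => //; exact: cuntz_S.
Qed.

(** A homomorphism that kills the projection would therefore kill 1. The witnesses are T_1 T_0^i and
    S_0^i S_1. *)
Lemma pow2_odd_full i : exists a b, [/\ O a, O b &
  a * maskop p1 (pow2_odd i) * b = 1].
Proof.
elim: i => [|i [a [b [Oa Ob ab]]]].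
  exists (opT p1 true), (opS p1 true); split; [exact: cuntz_T|exact: cuntz_S|].
  by apply: bopP => x; rewrite maskop_odd !bopME !opTS.
exists (a * opT p1 false), (opS p1 false * b); split.
- by apply: cuntz_mul => //; exact: cuntz_T.
- by apply: cuntz_mul => //; exact: cuntz_S.
by apply: bopP => x; rewrite maskop_pow2_oddS !bopME !opTS -!bopME ab.
Qed.

End odd_sets.

(** * Disjoint invariant supports obtained from the two homomorphisms *)

Theorem corollary4 (R : realType) (p : R) (p1 : 1 <= p) (p2 : p != 2) :
  ~ exists phi : bop (lp p1 (nat * nat)%type) -> bop (lp p1 nat),
      unital_contractive_hom
        (spatial_tensor (cuntz_alg p1) (cuntz_alg p1)) (cuntz_alg p1) phi.
Proof.
move=> [phi phi_hom].
have L := hom_left phi_hom; have R' := hom_right phi_hom.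
set psi := fun a => phi (tensop a 1) in L.
set psi' := fun b => phi (tensop 1 b) in R'.
have [sig [c [sigI sigc]]] := hom_S_delta p2 R'.
have sig_cyl1 j : exists N, forall n m, (N <= n)%N -> sig j (cyl n m) = cyl (sig j n) m.
  have Os : cuntz_alg p1 (psi' (opS p1 j)).
    by have [+ _ _ _ _] := R'; apply; exact: cuntz_S.
  (* Tolerance 1 suffices: the nonzero entries of the image of [opS p1 j] have modulus 1, so an
     entry at distance less than 1 from one of them is nonzero. *)
  have [N HN] := cuntz_cyl Os (ltr01 : 0 < 1).
  exists N => n m /HN[n0 nm].
  have cn1 : rnorm (c j n) = 1.
    have := hom_S_isometry R' j (delta p1 n).
    by rewrite -/psi' (sigc j n).2 lpnormZ !lpnorm_delta mulr1.
  (* An entry of modulus 1 in row 0 would contradict [n0]. *)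
  have sig0 : (0 < sig j n)%N.
    rewrite lt0n; apply/eqP => s0; move: n0.
    by rewrite (sigc j n).2 s0 lpZE deltaE eqxx mulr1 cn1 ltxx.
  have := nm m _ sig0; rewrite !(sigc j _).2 !lpZE !deltaE eqxx mulr1.
  case: eqP => [->//|_]; rewrite mulr0 sub0r /rnorm normrN -/(rnorm _).
  by rewrite cn1 ltxx.
have [N sig_cyl] : exists N, forall j n m, (N <= n)%N -> sig j (cyl n m) = cyl (sig j n) m.
  have [M HM] := sig_cyl1 false; have [N HN] := sig_cyl1 true.
  by exists (maxn M N) => -[] n m; rewrite geq_max => /andP[Mn Nn]; [exact: HN|exact: HM].
have OX i := @cuntz_maskop_pow2_odd _ _ p1 i.
have /choice[Y YE] i := hom_maskop p2 L (OX i).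
apply: (no_disjoint_invariant_sets sigI sig_cyl (X := Y)).
- move=> i; have OY : cuntz_alg p1 (psi (maskop p1 (pow2_odd i))).
    by have [+ _ _ _ _] := L; apply.
  have [M HM] := cuntz_cyl OY (ltr01 : 0 < 1).
  exists M.+1 => n m Mn; have n0 : (0 < n)%N by case: n Mn.
  have [_ /(_ m n n0)] := HM n (ltnW Mn).
  rewrite YE !maskop_delta !lpZE !deltaE !eqxx !mulr1.
  by case: (Y i _); case: (Y i _); rewrite // ?subr0 ?sub0r /rnorm ?normrN normr1 ltxx.
- move=> i j n.
  have comm := hom_commute phi_hom (OX i) (@cuntz_S _ _ p1 j).
  have : maskop p1 (Y i) (psi' (opS p1 j) (delta p1 n)) =
      psi' (opS p1 j) (maskop p1 (Y i) (delta p1 n)).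
    by rewrite -YE; refine (congr1 (fun a : bop (lp p1 nat) => a (delta p1 n)) comm).
  have bopZ (a : bop (lp p1 nat)) k (x : lp p1 nat) : a (k *: x) = k *: a x.
    exact: linearZ.
  rewrite (sigc j n).2 bopZ. rewrite (maskop_delta p1 (Y i) n) maskop_delta bopZ (sigc j n).2.
  move=> /(congr1 (fun x : lp p1 nat => x (sig j n))).
  rewrite !lpZE deltaE eqxx !mulr1 mulrC => /(mulIf (sigc j n).1).
  by case: (Y i _); case: (Y i _) => // /eqP; rewrite ?oner_eq0// eq_sym oner_eq0.
- move=> i; apply/not_existsP => Y0.
  have [a [b [Oa Ob ab]]] := @pow2_odd_full _ _ p1 i.
  have psiX0 : psi (maskop p1 (pow2_odd i)) = 0.
    rewrite YE -(maskop0 p1); congr maskop; apply/funext => n.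
    by apply/negP; exact: Y0.
  have := homM L (cuntz_mul Oa (OX i)) Ob.
  rewrite ab (homM L Oa (OX i)) -/psi psiX0 mulr0 mul0r (hom1 L).
  move=> /(congr1 (fun a : bop (lp p1 nat) => a (delta p1 0%N))).
  by rewrite bop1E; exact: delta_neq0.
move=> i j n Yin Yjn; apply/eqP/negPn/negP => ij.
have X0 : maskop p1 (pow2_odd i) * maskop p1 (pow2_odd j) = 0.
  rewrite maskopM -(maskop0 p1); congr maskop; apply/funext => k /=.
  by apply/negP => /andP[Xi /(pow2_odd_disjoint Xi)/eqP]; rewrite (negbTE ij).
have := homM L (OX i) (OX j); rewrite X0 (hom0 L) -/psi !YE maskopM.
move=> /(congr1 (fun a : bop (lp p1 nat) => a (delta p1 n) n)).
rewrite maskop_delta lpZE deltaE eqxx mulr1 /= Yin Yjn => /esym/eqP.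
by rewrite oner_eq0.
Qed.
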